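(* Let $n>1$ and $c\geq 1$ be integers and let $N_{n,c}$ be the free nilpotent group of rank $n$ and class $c$. There is a faithful representation $$N_{n,c}\otimes N_{n,c}\longrightarrow T_{c+2}(\mathbb{C})$$ into the group of triangular matrices $T_{c+2}(\mathbb{C})$.
   Context: $N_{n,c}=F_n/\gamma_{c+1}F_n$, where $F_n$ is the free group of rank $n$ and $\gamma_1F_n=F_n$, $\gamma_{k+1}F_n=[\gamma_kF_n,F_n]$ is the lower central series. $T_{m}(\mathbb{C})$ is the group of invertible upper triangular $m\times m$ matrices over $\mathbb{C}$. With $x^y=y^{-1}xy$, the non-abelian tensor square $G\otimes G$ of a group $G$ is the group generated by the symbols $g\otimes h$ ($g,h\in G$) subject to the relations $gg_1\otimes h=(g^{g_1}\otimes h^{g_1})(g_1\otimes h)$ and $g\otimes hh_1=(g\otimes h_1)(g^{h_1}\otimes h^{h_1})$ for all $g,g_1,h,h_1\in G$. A faithful representation is an injective homomorphism. *)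

(* Defs.v *)
From HB Require Import structures.
From mathcomp Require Import all_boot all_order all_algebra.
From mathcomp Require Import boolp classical_sets reals.
From mathcomp Require Import complex.

Set Implicit Arguments.
Unset Strict Implicit.
Unset Printing Implicit Defensive.

Local Open Scope quotient_scope.
Local Open Scope classical_set_scope.
Local Open Scope group_scope.

Section Subgroups.
Variable G : groupType.
Implicit Types A H N : set G.

Definition is_subgroup H : Prop :=
  [/\ H 1, (forall x y, H x -> H y -> H (x * y))
    & forall x, H x -> H x^-1].

Definition is_normal_subgroup N : Prop :=
  is_subgroup N /\ forall x g, N x -> N (x ^ g).

Definition gen A : set G := smallest is_subgroup A.

Definition normal_closure A : set G := smallest is_normal_subgroup A.

Definition comm_subgroup H K : set G :=
  gen [set [~ x, y] | x in H & y in K].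

(* Indexed as usual: [lcs 1 = G] and [lcs k.+1 = [lcs k, G]] for [k >= 1];
   [lcs 0 = G] is a junk value. *)
Definition lcs (k : nat) : set G :=
  iter k.-1 (fun H => comm_subgroup H setT) setT.

Lemma sub_gen A : A `<=` gen A.
Proof. by move=> x Ax H [_ AH]; exact: AH. Qed.

Lemma gen_subgroup A : is_subgroup (gen A).
Proof.
split=> [H [[]]//|x y Ax Ay H HA|x Ax H HA].
  by have [[_ HM _] _] := HA; apply: HM; [exact: Ax|exact: Ay].
by have [[_ _ HV] _] := HA; apply: HV; exact: Ax.
Qed.

Lemma gen_normal A : (forall x g, A x -> A (x ^ g)) ->
  is_normal_subgroup (gen A).
Proof.
move=> AJ; split=> [|x g Ax]; first exact: gen_subgroup.
have [g1 gM gV] := gen_subgroup A.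
apply: (Ax [set y | gen A (y ^ g)]); split=> [|y Ay]; last first.
  by apply: sub_gen; exact: AJ.
split=> [|y z|y] /=; first by rewrite conj1g.
  by rewrite conjMg; exact: gM.
by rewrite conjVg; exact: gV.
Qed.

Lemma normal_closure_normal A : is_normal_subgroup (normal_closure A).
Proof.
split; first split.
- by move=> H [[[]]].
- move=> x y Ax Ay H HA; have [[[_ HM _] _] _] := HA.
  by apply: HM; [exact: Ax|exact: Ay].
- by move=> x Ax H HA; have [[[_ _ HV] _] _] := HA; apply: HV; exact: Ax.
- by move=> x g Ax H HA; have [[_ HJ] _] := HA; apply: HJ; exact: Ax.
Qed.

Lemma lcs_normal k : is_normal_subgroup (lcs k).
Proof.
rewrite /lcs; elim: k.-1 => [//|{}k [_ IHk]] /=.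
apply: gen_normal => _ g [x Hx [y _ <-]].
exists (x ^ g); first exact: IHk.
by exists (y ^ g) => //; rewrite conjRg.
Qed.

Record normal_subgroup := NormalSubgroup {
  normal_set : set G;
  normal_setP : is_normal_subgroup normal_set }.

Definition lcs_nsub k := NormalSubgroup (lcs_normal k).
Definition closure_nsub A := NormalSubgroup (normal_closure_normal A).

End Subgroups.

Section Quotient.
Variables (G : groupType) (N : normal_subgroup G).

Definition coset_eq (x y : G) : bool := `[< normal_set N (x^-1 * y) >].

Lemma coset_eq_refl : reflexive coset_eq.
Proof.
have [[N1 _ _] _] := normal_setP N.
by move=> x; apply/asboolP; rewrite mulVg.
Qed.

Lemma coset_eq_sym : symmetric coset_eq.
Proof.
have [[_ _ NV] _] := normal_setP N.
by move=> x y; apply/asboolP/asboolP => /NV; rewrite invgM invgK.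
Qed.

Lemma coset_eq_trans : transitive coset_eq.
Proof.
have [[_ NM _] _] := normal_setP N.
move=> y x z /asboolP Nxy /asboolP Nyz; apply/asboolP.
by have := NM _ _ Nxy Nyz; rewrite mulgA mulgK.
Qed.

Canonical coset_equiv :=
  EquivRel coset_eq coset_eq_refl coset_eq_sym coset_eq_trans.

Definition quotient_group : Type := {eq_quot coset_equiv}.

HB.instance Definition _ := Choice.on quotient_group.
HB.instance Definition _ := EqQuotient.on quotient_group.

Implicit Types a b : quotient_group.

Let piQ (x : G) : quotient_group := \pi x.

Let piQ_eq x y : normal_set N (x^-1 * y) -> piQ x = piQ y.
Proof. by move=> Nxy; apply/eqmodP/asboolP. Qed.

Let piQ_repr x : normal_set N (x^-1 * repr (piQ x)).
Proof.
have /eqmodP/asboolP : x = repr (piQ x) %[mod quotient_group] by rewrite reprK.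
exact.
Qed.

Definition quotient_one : quotient_group := piQ 1.
Definition quotient_mul a b : quotient_group := piQ (repr a * repr b).
Definition quotient_inv a : quotient_group := piQ (repr a)^-1.

Lemma pi_quotient_mul x y : quotient_mul (piQ x) (piQ y) = piQ (x * y).
Proof.
have [[_ NM _] NJ] := normal_setP N.
apply/esym/piQ_eq; rewrite invgM.
have := NM _ _ (NJ _ y (piQ_repr x)) (piQ_repr y).
by rewrite /conjg !mulgA mulgK.
Qed.

Lemma pi_quotient_inv x : quotient_inv (piQ x) = piQ x^-1.
Proof.
have [_ NJ] := normal_setP N.
apply/piQ_eq; rewrite invgK.
have := NJ _ x^-1 (piQ_repr x).
by rewrite /conjg invgK mulgA mulgA mulgV mul1g.
Qed.

Let piQP a : exists x, a = piQ x.
Proof. by exists (repr a); rewrite /piQ reprK. Qed.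

Lemma quotient_mulA : associative quotient_mul.
Proof.
move=> a b c; have [x ->] := piQP a; have [y ->] := piQP b.
by have [z ->] := piQP c; rewrite !pi_quotient_mul mulgA.
Qed.

Lemma quotient_mul1 : left_id quotient_one quotient_mul.
Proof. by move=> a; have [x ->] := piQP a; rewrite pi_quotient_mul mul1g. Qed.

Lemma quotient_mulr1 : right_id quotient_one quotient_mul.
Proof. by move=> a; have [x ->] := piQP a; rewrite pi_quotient_mul mulg1. Qed.

Lemma quotient_mulV : left_inverse quotient_one quotient_inv quotient_mul.
Proof.
by move=> a; have [x ->] := piQP a; rewrite pi_quotient_inv pi_quotient_mul mulVg.
Qed.

Lemma quotient_mulrV : right_inverse quotient_one quotient_inv quotient_mul.
Proof.
by move=> a; have [x ->] := piQP a; rewrite pi_quotient_inv pi_quotient_mul mulgV.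
Qed.

HB.instance Definition _ := isGroup.Build quotient_group
  quotient_mulA quotient_mul1 quotient_mulr1 quotient_mulV quotient_mulrV.

End Quotient.

Section FreeGroup.
Variable X : choiceType.

(* The letter [(x, true)] stands for [x] and [(x, false)] for its inverse. *)
Definition word : Type := seq (X * bool).

Definition winv (u : word) : word := rev [seq (l.1, ~~ l.2) | l <- u].

Inductive word_eq : word -> word -> Prop :=
| word_eq_cancel u v x b :
    word_eq (u ++ [:: (x, b); (x, ~~ b)] ++ v) (u ++ v)
| word_eq_refl u : word_eq u u
| word_eq_sym u v : word_eq u v -> word_eq v u
| word_eq_trans v u w : word_eq u v -> word_eq v w -> word_eq u w.

Definition word_eqb (u v : word) : bool := `[< word_eq u v >].

Lemma word_eqb_refl : reflexive word_eqb.
Proof. by move=> u; apply/asboolP; exact: word_eq_refl. Qed.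

Lemma word_eqb_sym : symmetric word_eqb.
Proof. by move=> u v; apply/asboolP/asboolP; exact: word_eq_sym. Qed.

Lemma word_eqb_trans : transitive word_eqb.
Proof.
by move=> v u w /asboolP uv /asboolP vw; apply/asboolP; exact: word_eq_trans vw.
Qed.

HB.instance Definition _ := Choice.on word.

Canonical word_equiv :=
  EquivRel word_eqb word_eqb_refl word_eqb_sym word_eqb_trans.

Definition free_group : Type := {eq_quot word_equiv}.

HB.instance Definition _ := Choice.on free_group.
HB.instance Definition _ := EqQuotient.on free_group.

Implicit Types a b : free_group.

Definition free_word (u : word) : free_group := \pi u.

Lemma free_word_eq u v : word_eq u v -> free_word u = free_word v.
Proof. by move=> uv; apply/eqmodP/asboolP. Qed.

Lemma free_word_repr u : word_eq u (repr (free_word u)).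
Proof.
have /eqmodP/asboolP : u = repr (free_word u) %[mod free_group] by rewrite reprK.
exact.
Qed.

Definition free_gen (x : X) : free_group := free_word [:: (x, true)].
Definition free_one : free_group := free_word [::].
Definition free_mul a b : free_group := free_word (repr a ++ repr b).
Definition free_inv a : free_group := free_word (winv (repr a)).

Lemma word_eq_catl w u v : word_eq u v -> word_eq (w ++ u) (w ++ v).
Proof.
elim=> {u v} [u v x b|u|u v _|v u t _ + _].
- by have := word_eq_cancel (w ++ u) v x b; rewrite -!catA.
- exact: word_eq_refl.
- exact: word_eq_sym.
- exact: word_eq_trans.
Qed.

Lemma word_eq_catr w u v : word_eq u v -> word_eq (u ++ w) (v ++ w).
Proof.
elim=> {u v} [u v x b|u|u v _|v u t _ + _].
- by have := word_eq_cancel u (v ++ w) x b; rewrite -!catA.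
- exact: word_eq_refl.
- exact: word_eq_sym.
- exact: word_eq_trans.
Qed.

Lemma winv_cat u v : winv (u ++ v) = winv v ++ winv u.
Proof. by rewrite /winv map_cat rev_cat. Qed.

Lemma winvK : involutive winv.
Proof.
move=> u; rewrite /winv map_rev revK -map_comp map_id_in // => -[x b] _ /=.
by rewrite negbK.
Qed.

Lemma word_eq_winv u v : word_eq u v -> word_eq (winv u) (winv v).
Proof.
elim=> {u v} [u v x b|u|u v _|v u t _ + _].
- have := word_eq_cancel (winv v) (winv u) x b.
  by rewrite !winv_cat -catA /winv /rev /= negbK.
- exact: word_eq_refl.
- exact: word_eq_sym.
- exact: word_eq_trans.
Qed.

Lemma word_eq_mulV u : word_eq (u ++ winv u) [::].
Proof.
elim: u => [|[x b] u IHu]; first exact: word_eq_refl.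
rewrite -cat1s winv_cat -catA [u ++ _]catA.
apply: word_eq_trans (word_eq_catl _ (word_eq_catr _ IHu)) _.
exact: (word_eq_cancel [::] [::]).
Qed.

Lemma free_mulE u v : free_mul (free_word u) (free_word v) = free_word (u ++ v).
Proof.
apply/esym/free_word_eq; apply: word_eq_trans (word_eq_catr _ (free_word_repr u)) _.
exact/word_eq_catl/free_word_repr.
Qed.

Lemma free_invE u : free_inv (free_word u) = free_word (winv u).
Proof. exact/esym/free_word_eq/word_eq_winv/free_word_repr. Qed.

Lemma free_wordP a : exists u, a = free_word u.
Proof. by exists (repr a); rewrite /free_word reprK. Qed.

Lemma free_mulA : associative free_mul.
Proof.
move=> a b c; have [u ->] := free_wordP a; have [v ->] := free_wordP b.
by have [w ->] := free_wordP c; rewrite !free_mulE catA.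
Qed.

Lemma free_mul1 : left_id free_one free_mul.
Proof. by move=> a; have [u ->] := free_wordP a; rewrite free_mulE. Qed.

Lemma free_mulr1 : right_id free_one free_mul.
Proof. by move=> a; have [u ->] := free_wordP a; rewrite free_mulE cats0. Qed.

Lemma free_mulV : left_inverse free_one free_inv free_mul.
Proof.
move=> a; have [u ->] := free_wordP a; rewrite free_invE free_mulE.
by apply: free_word_eq; rewrite -{2}[u]winvK; exact: word_eq_mulV.
Qed.

Lemma free_mulrV : right_inverse free_one free_inv free_mul.
Proof.
move=> a; have [u ->] := free_wordP a; rewrite free_invE free_mulE.
by apply: free_word_eq; exact: word_eq_mulV.
Qed.

HB.instance Definition _ := isGroup.Build free_group
  free_mulA free_mul1 free_mulr1 free_mulV free_mulrV.

End FreeGroup.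

Definition presented_group (X : choiceType)
    (R : free_group X -> free_group X -> Prop) : groupType :=
  quotient_group
    (closure_nsub [set r | exists u v, R u v /\ r = u * v^-1]).

Definition free_nilpotent (n c : nat) : groupType :=
  quotient_group (lcs_nsub (free_group 'I_n) c.+1).

Section TensorSquare.
Variable G : groupType.

Definition tens (g h : G) : free_group (G * G)%type := free_gen (g, h).

(* The symbols [tens g h] live in the free group on [G * G];
   [g ^ x] is the conjugate [x^-1 * (g * x)]. *)
Inductive tensor_rel :
    free_group (G * G)%type -> free_group (G * G)%type -> Prop :=
| tensor_rel_mull g g1 h :
    tensor_rel (tens (g * g1) h) (tens (g ^ g1) (h ^ g1) * tens g1 h)
| tensor_rel_mulr g h h1 :
    tensor_rel (tens g (h * h1)) (tens g h1 * tens (g ^ h1) (h ^ h1)).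

Definition tensor_square : groupType := presented_group tensor_rel.

End TensorSquare.

Section Triangular.
Variables (F : fieldType) (m : nat).

(* [is_trig_mx] means lower triangular, hence the transpose. *)
Definition inv_upper : pred 'M[F]_m :=
  [pred A | is_trig_mx A^T & A \in unitmx].

Definition triangular : Type := {A : 'M[F]_m | inv_upper A}.

HB.instance Definition _ := SubChoice.on triangular.

Lemma trigmx_mul (A B : 'M[F]_m) :
  is_trig_mx A -> is_trig_mx B -> is_trig_mx (A *m B).
Proof.
move=> /is_trig_mxP tA /is_trig_mxP tB; apply/is_trig_mxP => i j ij.
rewrite mxE big1 // => k _; case: (ltnP i k) => [ik|ki].
  by rewrite tA // GRing.mul0r.
by rewrite tB ?GRing.mulr0 // (leq_ltn_trans ki ij).
Qed.

Lemma trigmx_inv (A : 'M[F]_m) :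
  A \in unitmx -> is_trig_mx A -> is_trig_mx (invmx A).
Proof.
move=> uA tA; apply/is_trig_mxP => i j.
have /is_trig_mxP tA' := tA.
have dA k : A k k != GRing.zero.
  move: uA; rewrite unitmxE (det_trig tA) GRing.unitfE.
  by move/GRing.prodf_neq0; exact.
elim/ltn_ind: {i}(val i) {-2}i (erefl (val i)) => k IHk i ik ij.
have /matrixP/(_ i j) := mulmxV uA; rewrite !mxE.
have -> : (i == j) = false by apply/eqP => eij; rewrite eij ltnn in ij.
rewrite (bigD1 i) //= big1 => [|l li]; last first.
  case: (ltngtP l i) => [lti|gti|eli].
  - by rewrite (IHk l) ?GRing.mulr0 -?ik // (ltn_trans lti).
  - by rewrite tA' // GRing.mul0r.
  - by rewrite (val_inj eli) eqxx in li.
move/eqP; rewrite GRing.addr0 GRing.mulf_eq0 (negPf (dA i)) /=.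
by move/eqP.
Qed.

Lemma inv_upper1 : inv_upper 1%:M%R.
Proof. by rewrite /inv_upper /= trmx1 unitmx1 scalar_mx_is_trig. Qed.

Lemma inv_upperM (A B : 'M[F]_m) :
  inv_upper A -> inv_upper B -> inv_upper (A *m B)%R.
Proof.
move=> /andP[tA uA] /andP[tB uB].
by rewrite /inv_upper /= trmx_mul trigmx_mul // unitmx_mul uA.
Qed.

Lemma inv_upperV (A : 'M[F]_m) : inv_upper A -> inv_upper (invmx A).
Proof.
move=> /andP[tA uA].
by rewrite /inv_upper /= trmx_inv trigmx_inv ?unitmx_tr // unitmx_inv.
Qed.

Definition tri_one : triangular := exist (fun A => inv_upper A) _ inv_upper1.
Definition tri_mul (A B : triangular) : triangular :=
  exist (fun A => inv_upper A) _ (inv_upperM (svalP A) (svalP B)).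
Definition tri_inv (A : triangular) : triangular :=
  exist (fun A => inv_upper A) _ (inv_upperV (svalP A)).

Lemma tri_mulA : associative tri_mul.
Proof. by move=> A B C; apply: val_inj; rewrite /= mulmxA. Qed.

Lemma tri_mul1 : left_id tri_one tri_mul.
Proof. by move=> A; apply: val_inj; rewrite /= mul1mx. Qed.

Lemma tri_mulr1 : right_id tri_one tri_mul.
Proof. by move=> A; apply: val_inj; rewrite /= mulmx1. Qed.

Lemma tri_mulV : left_inverse tri_one tri_inv tri_mul.
Proof.
by move=> [A uA]; apply: val_inj; rewrite /= mulVmx; case/andP: uA.
Qed.

Lemma tri_mulrV : right_inverse tri_one tri_inv tri_mul.
Proof.
by move=> [A uA]; apply: val_inj; rewrite /= mulmxV; case/andP: uA.
Qed.

HB.instance Definition _ := isGroup.Build triangular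
  tri_mulA tri_mul1 tri_mulr1 tri_mulV tri_mulrV.

End Triangular.

(* Main.v *)
Require Import Defs.
From HB Require Import structures.
From mathcomp Require Import all_boot all_order all_algebra.
From mathcomp Require Import boolp classical_sets functions cardinality reals.
From mathcomp Require Import ereal sequences exp lebesgue_measure.
From mathcomp Require Import complex polyrcf zify.

(** Let [G] be the free nilpotent group, the quotient of a free group [F] by
    [lcs c.+1], and [T] its tensor square. The theorem comes from two
    homomorphisms on [T] whose kernels meet trivially ([rep_sig_ker]).

    The first one, [rep], sends [g (x) h] to the commutator of two matrices
    representing lifts of [g] and [h] to [F]. Here [F] is represented by [mu]
    over [{poly int}]: a letter goes to a unitriangular matrix of size [c + 2]
    with monomials on the superdiagonal. Lifts are determined up to
    [lcs c.+1], which is mapped to central matrices, so that the commutator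
    depends on [g] and [h] only. The second one, [sig], is the projection to the
    symmetric square of the abelianization of [G].

    The kernel of [rep] is contained in the symmetric part of [T], generated by
    the [g (x) g] and the [(g (x) h) (h (x) g)]. To see this, filter [T] by
    weight, [x (x) y] having weight [i + j] when [x] is in [lcs i] and [y] in
    [lcs j] ([tfil], [tfil_tns]). Modulo higher weight the symbols are
    bilinear and alternating and satisfy the Jacobi identity ([qmod_jacobi]), as
    a Lie bracket would. Hence the classical rewriting argument for Lyndon words
    applies and shows that weight [k] is spanned by one symbol for each Lyndon
    word of length [k] ([lspan_bracket], [tfil_span]). The exponents of the
    monomials in [mu] are such that the exponent of a product of matrices along
    a word is the value of that word in some base, so lexicographic comparison
    of words becomes comparison of exponents; since the Lyndon word [w] is the
    least word occurring in the expansion of its bracket, the matrix of its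
    symbol has an entry with lowest term ['X^(value of w)] ([lowest_lcomm]).
    Different words give different exponents, so an element of weight [k] in the
    kernel has weight [k + 1] ([rep_ker_step]). At weight [c + 2] only the
    symmetric part is left, because [lcs c.+1] is trivial in [G].

    The symmetric part is central, and generated by the [x_i (x) x_i] and the
    [(x_i (x) x_j) (x_j (x) x_i)] with [i < j], which [sig] maps to nonzero
    multiples of different monomials; so [sig] is injective on it ([sig_ker]).

    Finally a transcendental real number is substituted for ['X], and [t] is
    sent to the exponential of [sig t] times the unipotent matrix [rep t]. *)

Set Implicit Arguments.
Unset Strict Implicit.
Unset Printing Implicit Defensive.

(** * Lyndon words *)

Section LyndonWords.
Import Order.TTheory Order.DefaultSeqLexiOrder.
Context {d : Order.disp_t} {X : orderType d}.
Implicit Types u v w s t : seq X.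
Local Open Scope order_scope.

Lemma ltxi_cat2l u s t : (u ++ s < u ++ t) = (s < t).
Proof. by elim: u => //= x u IHu; rewrite ltxi_cons lexx. Qed.

Lemma ltxi_catr u s : s != [::] -> u < u ++ s.
Proof. by move=> s0; rewrite -{1}[u]cats0 ltxi_cat2l ltxi0s. Qed.

(** Two words compare either because one is a prefix of the other or at a first
    differing letter; in the second case the comparison survives arbitrary
    continuations. *)
Lemma ltxi_prefixVcat u v : u < v ->
  (exists2 t, t != [::] & v = u ++ t) \/ forall s t, u ++ s < v ++ t.
Proof.
elim: u v => [|x u IHu] [|y v] //.
  by move=> _; left; exists (y :: v).
rewrite ltxi_cons => /andP[le_xy /implyP lt_uv].
have [le_yx|lt_xy] := leP y x; last first.
  by right=> s t; rewrite /= ltxi_cons le_xy leNgt lt_xy.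
have {le_yx le_xy} exy : x = y by apply/eqP; rewrite eq_le le_xy.
move: lt_uv; rewrite exy lexx => /(_ isT)/IHu[[t t0 ->]|lt_uv].
  by left; exists t.
by right=> s t; rewrite /= ltxi_cons lexx; exact: lt_uv.
Qed.

Lemma cat_eqr p s : p ++ s = s -> p = [::].
Proof.
by move/(congr1 size)/eqP; rewrite size_cat -{2}[size s]add0n eqn_add2r => /nilP.
Qed.

Lemma cat_eq_cat p s u v : p ++ s = u ++ v ->
  (exists2 t, p = u ++ t & v = t ++ s)
  \/ exists t, [/\ t != [::], u = p ++ t & s = t ++ v].
Proof.
elim: p u => [|x p IHp] [|y u] /=.
- by move=> <-; left; exists [::].
- by move=> ->; right; exists (y :: u).
- by move=> <-; left; exists (x :: p).
- case=> -> /IHp[[t -> ->]|[t [t0 -> ->]]]; first by left; exists t.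
  by right; exists t.
Qed.

Definition lyndon w : Prop := w != [::] /\
  forall u v, u != [::] -> v != [::] -> w = u ++ v -> w < v.

Lemma lyndon1 (x : X) : lyndon [:: x].
Proof. by split=> // -[|y [|z u]] [|y' v]. Qed.

Lemma lyndon_cat_lt u v : lyndon u -> lyndon v -> u < v -> u ++ v < v.
Proof.
move=> [u0 _] [v0 Lv] uv.
have [[t t0 vE]|lt] := ltxi_prefixVcat uv; last by have := lt v [::]; rewrite cats0.
by rewrite [in X in _ < X]vE ltxi_cat2l; apply: (Lv u).
Qed.

Lemma lyndon_cat u v : lyndon u -> lyndon v -> u < v -> lyndon (u ++ v).
Proof.
move=> Lu Lv uv; have uvv := lyndon_cat_lt Lu Lv uv.
have [[u0 Lu'] [v0 Lv']] := (Lu, Lv).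
split=> [|p s p0 s0 E]; first by case: (u) u0.
have [[q pE vE]|[q [q0 uE sE]]] := cat_eq_cat (esym E).
  case: q {pE} vE => [/= <- //|y q vE].
  by apply: (lt_trans uvv); apply: (Lv' (y :: q)).
have {Lu'} lt_uq := Lu' _ _ p0 q0 uE.
have [[t _ qE]|lt] := ltxi_prefixVcat lt_uq; last by rewrite sE.
(* A proper suffix of [u] is too short to have [u] as a prefix. *)
have := congr1 size uE; rewrite qE !size_cat => /eqP.
rewrite addnCA -[eqbLHS]addn0 eqn_add2l eq_sym addn_eq0 => /andP[/nilP pE _].
by rewrite pE in p0.
Qed.

Fixpoint minsuf s :=
  if s is x :: s' then
    if s' == [::] then s else if s < minsuf s' then s else minsuf s'
  else [::].

Lemma minsuf_neq0 s : s != [::] -> minsuf s != [::].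
Proof.
elim: s => //= x s IHs _; case: ifP => // /negbT s0.
by case: ifP => // _; exact: IHs.
Qed.

Lemma minsuf_suffix s : exists u, s = u ++ minsuf s.
Proof.
elim: s => [|x s [u IHs]] /=; first by exists [::].
case: ifP => _; first by exists [::].
by case: ifP => _; [exists [::]|exists (x :: u); rewrite {1}IHs].
Qed.

Lemma minsuf_le s u v : s = u ++ v -> v != [::] -> minsuf s <= v.
Proof.
elim: s u => [|x s IHs] [|y u] //=.
  move=> <- _; case: ifP => _; first exact: lexx.
  case: ifP => [_|/negbT]; first exact: lexx.
  by rewrite -leNgt.
case=> _ E v0; case: ifP => [/eqP s0|_]; first
  by move: E v0; rewrite s0; case: (u) => //= <-.
have le := IHs _ E v0.
by case: ifP => // lt; exact: le_trans (ltW lt) le.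
Qed.

(** The standard factorization [w = lfac w ++ rfac w] of a Lyndon word; its
    right factor is taken to be the least proper suffix, which makes all the
    facts below comparisons of suffixes. *)
Definition rfac w := minsuf (behead w).
Definition lfac w := take (size w - size (rfac w)) w.

Lemma fac_cat w : lfac w ++ rfac w = w.
Proof.
case: w => [|x w] //; have [u wE] := minsuf_suffix w.
rewrite /lfac [rfac _]/(minsuf w); set r := minsuf w in wE *.
have -> : x :: w = (x :: u) ++ r by rewrite /= -wE.
by rewrite size_cat addnK take_size_cat.
Qed.

Lemma rfac_neq0 w : (1 < size w)%N -> rfac w != [::].
Proof. by case: w => [|x [|y w]] // _; apply: minsuf_neq0. Qed.

Lemma lfac_neq0 w : (1 < size w)%N -> lfac w != [::].
Proof.
case: w => [|x w] // _; have [u wE] := minsuf_suffix w.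
rewrite -size_eq0 /lfac size_takel ?leq_subr // subn_eq0 -ltnNge.
by rewrite [rfac _]/(minsuf w) -[size (_ :: _)]/(size w).+1 ltnS (congr1 size wE) size_cat leq_addl.
Qed.

Lemma size_fac w : (1 < size w)%N ->
  [/\ (size (lfac w) < size w)%N, (size (rfac w) < size w)%N,
      (0 < size (lfac w))%N, (0 < size (rfac w))%N
    & (size (lfac w) + size (rfac w) = size w)%N].
Proof.
move=> w1; have E := congr1 size (fac_cat w); rewrite size_cat in E.
have := lfac_neq0 w1; have := rfac_neq0 w1; rewrite -!size_eq0 -!lt0n => r0 l0.
split=> //; first by rewrite -E -[ltnLHS]addn0 ltn_add2l.
by rewrite -E -[ltnLHS]add0n ltn_add2r.
Qed.

Lemma rfac_le w u v : u != [::] -> v != [::] -> w = u ++ v -> rfac w <= v.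
Proof. by case: u => // x u _ v0 ->; apply: (minsuf_le (u := u)). Qed.

Lemma lyndon_rfac w : lyndon w -> (1 < size w)%N -> lyndon (rfac w).
Proof.
move=> [_ Lw] w1; split=> [|p s p0 s0 E]; first exact: rfac_neq0.
have wE : w = (lfac w ++ p) ++ s by rewrite -catA -E fac_cat.
rewrite lt_neqAle (rfac_le _ s0 wE) ?andbT; last by case: (lfac w).
by apply/eqP; rewrite E => /cat_eqr pE; rewrite pE in p0.
Qed.

Lemma lyndon_lfac w : lyndon w -> (1 < size w)%N -> lyndon (lfac w).
Proof.
move=> [_ Lw] w1; split=> [|p s p0 s0 E]; first exact: lfac_neq0.
have v0 := rfac_neq0 w1; set v := rfac w in v0 *.
have wE : w = p ++ (s ++ v) by rewrite catA -E fac_cat.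
have lt_wsv : w < s ++ v by apply: (Lw p) => //; case: (s) s0.
case: (ltgtP (lfac w) s) => // [lt_su|Es]; last first.
  by move: E; rewrite Es => /esym/cat_eqr pE; rewrite pE in p0.
have [[t t0 uE]|lt] := ltxi_prefixVcat lt_su; last first.
  by have := lt_trans lt_wsv (lt v v); rewrite fac_cat ltxx.
have : t ++ v < v by rewrite -(ltxi_cat2l s) catA -uE fac_cat.
have tv0 : t ++ v != [::] by case: (t) t0.
have sE : w = s ++ (t ++ v) by rewrite catA -uE fac_cat.
by rewrite ltNge (rfac_le s0 tv0 sE).
Qed.

Lemma lfac_lt_rfac w : lyndon w -> (1 < size w)%N -> lfac w < rfac w.
Proof.
move=> [_ Lw] w1; have v0 := rfac_neq0 w1.
apply: lt_trans (Lw _ _ (lfac_neq0 w1) v0 (esym (fac_cat w))).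
by rewrite -{2}(fac_cat w) ltxi_catr.
Qed.

Lemma rfac_lyndon_cat u v : lyndon u -> lyndon v -> u < v ->
  (size u = 1%N \/ v <= rfac u) -> rfac (u ++ v) = v.
Proof.
move=> Lu Lv uv H.
have [u0 v0] : u != [::] /\ v != [::] by case: Lu Lv => ? _ [].
apply/eqP; rewrite eq_le (rfac_le u0 v0) //=.
have uv1 : (1 < size (u ++ v))%N.
  by rewrite size_cat; case: (u) (v) u0 v0 => // ? ? [] //= *; rewrite addnS.
have := fac_cat (u ++ v); have := rfac_neq0 uv1; have := lfac_neq0 uv1.
move: (lfac _) (rfac _) => p s p0 s0 E.
have [[q _ vE]|[q [q0 uE sE]]] := cat_eq_cat E.
  case: q vE => [/= -> //|y q vE].
  by case: Lv => _ Lv; apply/ltW/(Lv (y :: q)).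
case: H => [u1|le_vu].
  have := congr1 size uE; rewrite size_cat u1.
  by case: (p) (q) p0 q0 => [|? ?] [|? ?] //= _ _; rewrite addnS.
rewrite sE; apply: le_trans (le_trans le_vu (rfac_le p0 q0 uE)) _.
exact/ltW/ltxi_catr.
Qed.

Lemma lfac_lyndon_cat u v : lyndon u -> lyndon v -> u < v ->
  (size u = 1%N \/ v <= rfac u) -> lfac (u ++ v) = u.
Proof.
move=> Lu Lv uv H; rewrite /lfac rfac_lyndon_cat // size_cat addnK.
by rewrite take_size_cat.
Qed.

End LyndonWords.
(** * Subgroups, quotients and universal properties *)

Section Groups.
Local Open Scope group_scope.
Local Open Scope classical_set_scope.
Implicit Types (G H : groupType).

Section Morphisms.
Variables (G H : groupType) (f : G -> H).
Hypothesis fM : {morph f : x y / x * y}.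

Lemma morphg1 : f 1 = 1.
Proof. by apply: (mulIg (f 1)); rewrite -fM !mul1g. Qed.

Lemma morphgV : {morph f : x / x^-1}.
Proof. by move=> x; apply: (mulIg (f x)); rewrite -fM !mulVg morphg1. Qed.

Lemma morphgJ : {morph f : x y / x ^ y}.
Proof. by move=> x y; rewrite !conjgE !fM morphgV. Qed.

Lemma morphgR : {morph f : x y / [~ x, y]}.
Proof. by move=> x y; rewrite !commgEl fM morphgV morphgJ. Qed.

Lemma preim_subgroup (A : set H) : is_subgroup A -> is_subgroup (f @^-1` A).
Proof.
case=> A1 AM AV; split=> [|x y|x] /=; first by rewrite morphg1.
  by rewrite fM; exact: AM.
by rewrite morphgV; exact: AV.
Qed.
End Morphisms.

Lemma gen_min G (A B : set G) : is_subgroup B -> A `<=` B -> gen A `<=` B.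
Proof. exact: smallest_sub. Qed.

Lemma gen_sub G (A B : set G) : A `<=` B -> gen A `<=` gen B.
Proof.
by move=> AB; apply: gen_min (gen_subgroup B) _ => x /AB; exact: sub_gen.
Qed.

Lemma gen1 G (A : set G) : gen A 1.
Proof. by case: (gen_subgroup A). Qed.

Lemma subgroupVE G (A : set G) x : is_subgroup A -> A x^-1 = A x.
Proof.
case=> _ _ AV; rewrite propeqE; split; last exact: AV.
by move/AV; rewrite invgK.
Qed.

Lemma subgroupMl G (A : set G) x y : is_subgroup A -> A x -> A (x * y) = A y.
Proof.
case=> _ AM AV Ax; rewrite propeqE; split; last exact: AM.
by move/(AM _ _ (AV _ Ax)); rewrite mulKg.
Qed.

Lemma lcs_subgroup G k : is_subgroup (lcs (G := G) k).
Proof. by case: (lcs_normal G k). Qed.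

Lemma lcsS G k : lcs (G := G) k.+2 = comm_subgroup (lcs k.+1) setT.
Proof. by []. Qed.

Lemma lcs_comm G k (x g : G) : lcs k x -> lcs k.+1 [~ x, g].
Proof.
case: k => [|k] kx; first by [].
by rewrite lcsS; apply: sub_gen; exists x => //; exists g.
Qed.

Lemma lcs_leq G k l : k <= l -> lcs (G := G) l `<=` lcs k.
Proof.
move=> kl; rewrite -(subnKC kl); elim: (l - k) => [|m IH]; first by rewrite addn0.
apply: subset_trans IH; rewrite addnS; case: (k + m) => [|j] // x.
rewrite lcsS; apply: gen_min => [|_ [y yj [g _ <-]]]; first exact: lcs_subgroup.
have [sJ NJ] := lcs_normal G j.+1; have [_ JM JV] := sJ.
by rewrite commgEl; apply: JM; [exact: JV|exact: NJ].
Qed.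

Lemma lcs_ind G k (B : set G) : is_subgroup B ->
  (forall x g, lcs k.+1 x -> B [~ x, g]) -> lcs k.+2 `<=` B.
Proof.
move=> sB BR; rewrite lcsS; apply: gen_min => // _ [x kx [g _ <-]]; exact: BR.
Qed.

Section QuotientProjection.
Variables (G : groupType) (N : normal_subgroup G).
Local Open Scope quotient_scope.

Definition qpi (x : G) : quotient_group N := \pi x.

Lemma qpiM : {morph qpi : x y / x * y}.
Proof. by move=> x y; rewrite -[RHS]/(quotient_mul _ _) pi_quotient_mul. Qed.

Lemma qpi_eq x y : qpi x = qpi y <-> normal_set N (x^-1 * y).
Proof.
split=> [/eqmodP/asboolP //|Nxy]; exact/eqmodP/asboolP.
Qed.

Lemma qpiK a : qpi (repr a) = a.
Proof. exact: reprK. Qed.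

Lemma qpi_eq1 x : qpi x = 1 <-> normal_set N x.
Proof.
have [sN _] := normal_setP N.
by rewrite -(morphg1 qpiM) qpi_eq mulg1 subgroupVE.
Qed.

Lemma lcs_qpi k a : lcs k a -> exists2 x, lcs k x & qpi x = a.
Proof.
case: k => [_|k]; first by exists (repr a); rewrite ?qpiK.
elim: k a => [|k IHk] a; first by exists (repr a); rewrite ?qpiK.
move: a; apply: lcs_ind => [|_ b /IHk[x kx <-]]; last first.
  exists [~ x, repr b]; first exact: lcs_comm.
  by rewrite (morphgR qpiM) qpiK.
have [l1 lM lV] := lcs_subgroup G k.+2.
split=> [|_ _ [x kx <-] [y ky <-]|_ [x kx <-]].
- by exists 1 => //; exact: (morphg1 qpiM).
- by exists (x * y); [exact: lM|exact: qpiM].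
- by exists x^-1; [exact: lV|exact: (morphgV qpiM)].
Qed.

End QuotientProjection.

Section FreeLift.
Variables (X : choiceType) (H : groupType) (f : X -> H).

Fixpoint eval_word (u : word X) : H :=
  if u is l :: u' then (if l.2 then f l.1 else (f l.1)^-1) * eval_word u'
  else 1.

Lemma eval_word_cat u v : eval_word (u ++ v) = eval_word u * eval_word v.
Proof. by elim: u => [|l u IHu] /=; rewrite ?mul1g // IHu mulgA. Qed.

Lemma eval_word_eq u v : word_eq u v -> eval_word u = eval_word v.
Proof.
elim=> {u v} [u v x b|u|u v _|v u t _ + _] //; last by move=> ->.
rewrite !eval_word_cat /= mulg1 -[in RHS](mul1g (eval_word v)); congr (_ * (_ * _)).
by case: b; rewrite /= ?mulgV ?mulVg.
Qed.

Definition free_lift (a : free_group X) : H := eval_word (repr a).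

Lemma free_liftE u : free_lift (free_word u) = eval_word u.
Proof. exact/esym/eval_word_eq/free_word_repr. Qed.

Lemma free_lift_gen x : free_lift (free_gen x) = f x.
Proof. by rewrite free_liftE /= mulg1. Qed.

Lemma free_liftM : {morph free_lift : a b / a * b}.
Proof.
move=> a b; have [u ->] := free_wordP a; have [v ->] := free_wordP b.
by rewrite -[_ * _]/(free_mul _ _) free_mulE !free_liftE eval_word_cat.
Qed.

Lemma free_group_ind (B : set (free_group X)) : is_subgroup B ->
  (forall x, B (free_gen x)) -> forall a, B a.
Proof.
move=> [B1 BM BV] BX a; have [u ->] := free_wordP a.
elim: u => [//|[x b] u IHu].
have -> : free_word ((x, b) :: u) = free_word [:: (x, b)] * free_word u.
  by rewrite -[_ * _]/(free_mul _ _) free_mulE.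
apply: BM => //; case: b; first exact: BX.
have -> : free_word [:: (x, false)] = (free_gen x)^-1.
  by rewrite -[_^-1]/(free_inv _) free_invE.
exact: BV.
Qed.

End FreeLift.

Section TensorLift.
Variable G : groupType.
Notation T := (tensor_square G).

Definition tns (g h : G) : T := qpi _ (tens g h).

Lemma tns_mull g g1 h : tns (g * g1) h = tns (g ^ g1) (h ^ g1) * tns g1 h.
Proof.
rewrite /tns -qpiM; apply/divg1_eq; rewrite -(morphgV (qpiM _)) -qpiM.
apply/qpi_eq1 => B [nB]; apply.
by exists (tens (g * g1) h); eexists; split; first exact: tensor_rel_mull.
Qed.

Lemma tns_mulr g h h1 : tns g (h * h1) = tns g h1 * tns (g ^ h1) (h ^ h1).
Proof.
rewrite /tns -qpiM; apply/divg1_eq; rewrite -(morphgV (qpiM _)) -qpiM.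
apply/qpi_eq1 => B [nB]; apply.
by exists (tens g (h * h1)); eexists; split; first exact: tensor_rel_mulr.
Qed.

Lemma tensor_ind (B : set T) : is_subgroup B ->
  (forall g h, B (tns g h)) -> forall t, B t.
Proof.
move=> sB BT t; rewrite -(qpiK t).
move: (repr t); apply: (free_group_ind (B := qpi _ @^-1` B)) => [|[g h]].
  exact: (preim_subgroup (qpiM _) sB).
exact: BT.
Qed.

Lemma tensor_eq (H : groupType) (f f' : T -> H) :
  {morph f : x y / x * y} -> {morph f' : x y / x * y} ->
  (forall g h, f (tns g h) = f' (tns g h)) -> f =1 f'.
Proof.
move=> fM f'M E; apply: (tensor_ind (B := [set t | f t = f' t])) E.
split=> [|x y /= xE yE|x /= xE]; first by rewrite /= (morphg1 fM) (morphg1 f'M).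
  by rewrite fM f'M xE yE.
by rewrite (morphgV fM) (morphgV f'M) xE.
Qed.

Variables (H : groupType) (f : G -> G -> H).

(** Defined for arbitrary [f], so that no proof occurs in the terms [tensor_lift f];
    it is a homomorphism when [f] satisfies the defining relations. *)
Definition tensor_lift (t : T) : H :=
  free_lift (fun p => f p.1 p.2) (repr t).

Hypothesis f_mull : forall g g1 h, f (g * g1) h = f (g ^ g1) (h ^ g1) * f g1 h.
Hypothesis f_mulr : forall g h h1, f g (h * h1) = f g h1 * f (g ^ h1) (h ^ h1).

Lemma tensor_lift_pi a :
  tensor_lift (qpi _ a) = free_lift (fun p => f p.1 p.2) a.
Proof.
set F := free_lift _; have FM : {morph F : x y / x * y} := free_liftM _.
have : normal_set (closure_nsub [set r | exists u v,
    tensor_rel u v /\ r = u * v^-1]) ((repr (qpi _ a : T))^-1 * a).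
  by apply/qpi_eq; rewrite qpiK.
move/(_ [set x | F x = 1]) => Fa.
have /Fa : is_normal_subgroup [set x | F x = 1] /\
    [set r | exists u v, tensor_rel u v /\ r = u * v^-1] `<=` [set x | F x = 1].
  split; first split; first split => /=.
  - exact: (morphg1 FM).
  - by move=> x y Fx Fy; rewrite FM Fx Fy mulg1.
  - by move=> x Fx; rewrite (morphgV FM) Fx invg1.
  - by move=> x g /= Fx; rewrite (morphgJ FM) Fx conj1g.
  move=> _ [u [v [uv ->]]] /=; rewrite FM (morphgV FM).
  apply/eqP; rewrite divg_eq1; apply/eqP.
  by case: uv => *; rewrite FM /F !free_lift_gen /=.
by rewrite /= FM (morphgV FM) => /mulg1_eq; rewrite invgK.
Qed.

Lemma tensor_liftM : {morph tensor_lift : x y / x * y}.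
Proof.
move=> x y; rewrite -(qpiK x) -(qpiK y) -qpiM !tensor_lift_pi.
exact: free_liftM.
Qed.

Lemma tensor_lift_tns g h : tensor_lift (tns g h) = f g h.
Proof. by rewrite tensor_lift_pi free_lift_gen. Qed.

End TensorLift.
End Groups.
(** * The crossed module structure of the tensor square *)

Section TensorSquareTheory.
Local Open Scope group_scope.
Local Open Scope classical_set_scope.
Variable G : groupType.
Notation T := (tensor_square G).
Implicit Types (g h k x y z : G) (s t : T).

Lemma tns1g h : tns 1 h = 1.
Proof.
apply: (mulIg (tns 1 h)); rewrite mul1g.
by rewrite -[in RHS](mulg1 1) tns_mull conj1g conjg1.
Qed.

Lemma tnsg1 g : tns g 1 = 1.
Proof.
apply: (mulIg (tns g 1)); rewrite mul1g.
by rewrite -[in RHS](mulg1 1) tns_mulr conj1g conjg1.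
Qed.

Definition tact k : T -> T := tensor_lift (fun g h => tns (g ^ k) (h ^ k)).

Lemma tactM k : {morph tact k : s t / s * t}.
Proof.
apply: tensor_liftM => a b c.
  by rewrite (conjJg a b k) (conjJg c b k) conjMg tns_mull.
by rewrite (conjJg a c k) (conjJg b c k) conjMg tns_mulr.
Qed.

Lemma tact_tns k g h : tact k (tns g h) = tns (g ^ k) (h ^ k).
Proof.
apply: tensor_lift_tns => a b c.
  by rewrite (conjJg a b k) (conjJg c b k) conjMg tns_mull.
by rewrite (conjJg a c k) (conjJg b c k) conjMg tns_mulr.
Qed.

Lemma tactMl k l t : tact (k * l) t = tact l (tact k t).
Proof.
move: t; apply: tensor_eq => [|s t|g h]; first exact: tactM.
  by rewrite !tactM.
by rewrite !tact_tns !conjgM.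
Qed.

Lemma tact1 t : tact 1 t = t.
Proof.
by move: t; apply: tensor_eq => [|//|g h]; [exact: tactM|rewrite tact_tns !conjg1].
Qed.

Lemma tact_tnsMl g g1 h : tns (g * g1) h = tact g1 (tns g h) * tns g1 h.
Proof. by rewrite tact_tns tns_mull. Qed.

Lemma tact_tnsMr g h h1 : tns g (h * h1) = tns g h1 * tact h1 (tns g h).
Proof. by rewrite tact_tns tns_mulr. Qed.

Definition tdel : T -> G := tensor_lift (fun g h => [~ g, h]).

Fact comm_mull g g1 h : [~ g * g1, h] = [~ g ^ g1, h ^ g1] * [~ g1, h].
Proof. by rewrite -conjRg !commgEl !conjgE !invgM !mulgA !mulgK. Qed.

Fact comm_mulr g h h1 : [~ g, h * h1] = [~ g, h1] * [~ g ^ h1, h ^ h1].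
Proof. by rewrite -conjRg !commgEl !conjgE !invgM !mulgA !(mulgK, mulgVK). Qed.

Lemma tdelM : {morph tdel : s t / s * t}.
Proof. by apply: tensor_liftM => a b c; [exact: comm_mull|exact: comm_mulr]. Qed.

Lemma tdel_tns g h : tdel (tns g h) = [~ g, h].
Proof. by apply: tensor_lift_tns => a b c; [exact: comm_mull|exact: comm_mulr]. Qed.

(** Expanding [g g1 (x) h h1] in the two possible orders gives
    [tact (h1 g1) (g (x) h) * (g1 (x) h1) = (g1 (x) h1) * tact (g1 h1) (g (x) h)]. *)
Lemma tns_conj_tns g h g1 h1 : tns g h ^ tns g1 h1 = tact [~ g1, h1] (tns g h).
Proof.
have E x y : tact (h1 * g1) (tns x y) * tns g1 h1
           = tns g1 h1 * tact (g1 * h1) (tns x y).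
  have := tact_tnsMl x g1 (y * h1); rewrite (tact_tnsMr (x * g1)).
  rewrite (tact_tnsMl x g1 h1) (tact_tnsMl x g1 y) !tact_tnsMr !tactM -!tactMl.
  by rewrite !mulgA => /mulIg; rewrite -!mulgA => /mulgI.
have := E (g ^ (h1 * g1)^-1) (h ^ (h1 * g1)^-1); rewrite -tact_tns -!tactMl.
rewrite mulVg tact1 => E'; rewrite conjgE E' mulKg; congr (tact _ _).
by rewrite invgM commgEl conjgE !mulgA.
Qed.

Lemma tconj s t : t ^ s = tact (tdel s) t.
Proof.
have H g1 h1 t' : t' ^ tns g1 h1 = tact [~ g1, h1] t'.
  move: t'; apply: (tensor_eq (f := fun t' => t' ^ tns g1 h1)) => [x y||g h].
  - by rewrite conjMg.
  - exact: tactM.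
  - exact: tns_conj_tns.
move: t; move: s; apply: tensor_ind => [|g1 h1 t]; last by rewrite H tdel_tns.
split=> [t|x y Ex Ey t|x Ex t] /=.
- by rewrite conjg1 (morphg1 tdelM) tact1.
- by rewrite tdelM tactMl conjgM Ex Ey.
- apply: (conjg_inj x); rewrite conjgKV Ex -tactMl -tdelM mulVg.
  by rewrite (morphg1 tdelM) tact1.
Qed.

Lemma tnsVl g k : tns g^-1 k = (tact g^-1 (tns g k))^-1.
Proof.
by apply/esym/mulg1_eq; rewrite -tact_tnsMl mulgV tns1g.
Qed.

(** On commutators the tensor product measures how far [t] is from being fixed
    by [k]; it suffices to expand [g (x) h k] also as [g (x) (h k h^-1) h]. *)
Lemma tns_del t k : tns (tdel t) k = t^-1 * tact k t.
Proof.
have H g h : tns [~ g, h] k = (tns g h)^-1 * tact k (tns g h).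
  have E : tns g h * tns (g ^ h) k = tns g k * tact k (tns g h).
    rewrite -tact_tnsMr; have -> : h * k = k ^ h^-1 * h by rewrite -conjgCV.
    by rewrite tns_mulr -conjgM mulVg conjg1.
  rewrite commgEl tact_tnsMl tnsVl (morphgV (tactM _)) -tactMl -commgEl.
  rewrite -tdel_tns -tconj conjgE !invgM invgK -!mulgA E.
  by rewrite mulKg.
move: t; apply: tensor_ind => [|g h]; last by rewrite tdel_tns H.
split=> [|s t /= Es Et|s /= Es] /=.
- by rewrite (morphg1 tdelM) (morphg1 (tactM k)) tns1g invg1 mulg1.
- rewrite tdelM tact_tnsMl Es Et -tconj tactM conjgE !invgM !mulgA.
  by rewrite !mulgK.
- rewrite (morphgV tdelM) tnsVl Es (morphgV (tactM k)) -(morphgV tdelM) -tconj.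
  by rewrite conjgE invgK -mulgA mulVKg invgM invgK.
Qed.

Lemma tact_fix t k : tdel t = 1 -> tact k t = t.
Proof.
by move=> t1; have := tns_del t k; rewrite t1 tns1g => /esym/mulg1_eq; rewrite invgK.
Qed.

Lemma tdel1_central t s : tdel t = 1 -> t * s = s * t.
Proof. by move=> t1; rewrite conjgC [t ^ s]tconj tact_fix. Qed.

(** The polarization of the quadratic map [g |-> g (x) g], see [tsqM]; both take
    values in the kernel of [tdel], which is central and fixed by [G]. *)
Definition tsym g h : T := tns g h * tns h g.

Lemma tdel_tsym g h : tdel (tsym g h) = 1.
Proof. by rewrite tdelM !tdel_tns -(invgR g h) mulgV. Qed.

Lemma tdel_sq g : tdel (tns g g) = 1.
Proof. by rewrite tdel_tns commgg. Qed.

Lemma tsymC g h : tsym g h = tsym h g.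
Proof.
apply: (mulgI (tns g h)); rewrite -(tdel1_central _ (tdel_tsym g h)).
by rewrite /tsym !mulgA.
Qed.

Lemma tsymMl g g1 h : tsym (g * g1) h = tsym g h * tsym g1 h.
Proof.
rewrite [tsym (g * g1) h]/tsym tact_tnsMl tact_tnsMr mulgA.
rewrite -(mulgA (tact g1 _) (tns g1 h)) -/(tsym g1 h) -mulgA.
rewrite (tdel1_central _ (tdel_tsym g1 h)) mulgA -tactM -/(tsym g h).
by rewrite tact_fix // tdel_tsym.
Qed.

Lemma tsqM g h : tns (g * h) (g * h) = tns g g * tns h h * tsym g h.
Proof.
rewrite tact_tnsMr !tact_tnsMl tactM (tact_fix _ (tdel_sq g)).
rewrite (tact_fix _ (tdel_sq g)); set q := tns g g; set r := tns h h.
have qC t : q * t = t * q := tdel1_central t (tdel_sq g).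
have rC t : r * t = t * r := tdel1_central t (tdel_sq h).
rewrite -mulgA (mulgA r) -(qC r) -(mulgA q) mulgA -(qC (tact h _)) -mulgA.
rewrite (mulgA (tact h _)) -(rC (tact h _)) -(mulgA r) -tactM.
by rewrite -/(tsym g h) tact_fix ?tdel_tsym // mulgA.
Qed.

End TensorSquareTheory.
(** * The weight filtration of the tensor square *)

Section TensorFiltration.
Local Open Scope group_scope.
Local Open Scope classical_set_scope.
Variable G : groupType.
Notation T := (tensor_square G).
Implicit Types (g h x y z : G) (s t : T).

Definition symmetric_symbols : set T :=
  [set t | (exists g, t = tns g g) \/ exists g h, t = tsym g h].

(** Only symbols with second factor of weight one are put in; that all the
    [x (x) y] of total weight [k] belong to [tfil k] is [tfil_tns]. The
    advantage is that [tfil c.+2] visibly reduces to the symmetric part when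
    [G] has class [c]. *)
Definition tfil k : set T :=
  gen ([set t | exists x g, lcs k.-1 x /\ t = tns x g] `|` symmetric_symbols).

Lemma tfil_subgroup k : is_subgroup (tfil k).
Proof. exact: gen_subgroup. Qed.

Lemma tfil_tact k g t : tfil k t -> tfil k (tact g t).
Proof.
move: t; apply: gen_min; first exact: (preim_subgroup (tactM g) (tfil_subgroup k)).
move=> _ [[x [h [kx ->]]]|[[x ->]|[x [h ->]]]]; apply: sub_gen.
- left; exists (x ^ g), (h ^ g); rewrite tact_tns; split=> //.
  by case: (lcs_normal G k.-1) => _; exact.
- by right; left; exists (x ^ g); rewrite tact_tns.
- by right; right; exists (x ^ g), (h ^ g); rewrite tactM !tact_tns.
Qed.

Lemma tfil_normal k : is_normal_subgroup (tfil k).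
Proof.
by split=> [|t s kt]; [exact: tfil_subgroup|rewrite tconj; exact: tfil_tact].
Qed.

Definition tfil_nsub k := NormalSubgroup (tfil_normal k).
Local Notation qmod k := (qpi (tfil_nsub k)).

Lemma qmod1 k t : tfil k t -> qmod k t = 1.
Proof. by move=> kt; apply/qpi_eq1. Qed.

Lemma tfil_sq k g : tfil k (tns g g).
Proof. by apply: sub_gen; right; left; exists g. Qed.

Lemma tfil_sym k g h : tfil k (tsym g h).
Proof. by apply: sub_gen; right; right; exists g, h. Qed.

Lemma tfil_leq k l : k <= l -> tfil l `<=` tfil k.
Proof.
move=> kl; apply: gen_sub => t [[x [g [lx ->]]]|]; last by right.
left; exists x, g; split=> //; move: lx; apply: lcs_leq.
by rewrite -!subn1 leq_sub2r.
Qed.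

Lemma tfil_tdel k t : tfil k t -> lcs k (tdel t).
Proof.
move: t; apply: (gen_min (B := @tdel G @^-1` lcs k)).
  exact: (preim_subgroup (@tdelM G) (lcs_subgroup G k)).
have l1 : lcs (G := G) k 1 by case: (lcs_subgroup G k).
move=> _ [[x [g [kx ->]]]|[[g ->]|[g [h ->]]]] /=; rewrite ?tdel_sq ?tdel_tsym //.
by rewrite tdel_tns; case: k kx {l1} => [//|[//|k]] kx; apply: lcs_comm.
Qed.

Lemma qmod_tact1 k g t : tfil k t -> qmod k.+1 (tact g t) = qmod k.+1 t.
Proof.
move=> kt; apply/esym/qpi_eq; rewrite /= -tns_del; apply: sub_gen; left.
by exists (tdel t), g; split=> //; exact: tfil_tdel.
Qed.

Lemma tact_tns_comm x y z (x' := x ^ z) (y' := [~ y, z]) :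
  tact z (tns x y) = tns x' y' * tact y' (tact [~ x, z] (tns x y) * tns [~ x, z] y).
Proof.
have E g : g * [~ g, z] = g ^ z by rewrite commgEl mulVKg.
by rewrite tact_tns -(E y) tact_tnsMr /x' -{2}(E x) tact_tnsMl.
Qed.

(** Induction on [j]: in the expansion [tact_tns_comm] all factors except
    [x ^ z (x) [y, z]] are known by induction, and modulo the next weight the
    two occurrences of [x (x) y] cancel since [G] acts trivially there. *)
Lemma tfil_tns i j x y : lcs i x -> lcs j y -> tfil (i + j) (tns x y).
Proof.
case: j => [|j] ix.
  move=> _; apply: sub_gen; left; exists x, y; split=> //; move: ix.
  by apply: lcs_leq; rewrite addn0 leq_pred.
elim: j i x y ix => [|j IHj] i x y ix.
  by move=> _; apply: sub_gen; left; exists x, y; rewrite addn1.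
rewrite addnS; set m := i + j.+1; move=> jy; move: y jy x ix.
apply: lcs_ind => [|y z jy x0 ix0].
  have [t1 tM tV] := tfil_subgroup m.+1.
  split=> [x _|y y1 Hy Hy1 x ix|y Hy x ix] /=; first by rewrite tnsg1.
    rewrite tact_tnsMr; apply: tM; first exact: Hy1.
    by apply: tfil_tact; apply: Hy.
  have := tnsg1 x; rewrite -(mulgV y) tact_tnsMr => /mulg1_eq.
  rewrite -(subgroupVE _ (tfil_subgroup _)) => ->.
  by apply: tfil_tact; apply: Hy.
have [_ lJ] := lcs_normal G i; set x := x0 ^ z^-1.
have ix : lcs i x by exact: lJ.
have t_m : tfil m (tns x y) by exact: IHj.
have a_m : tfil m.+1 (tns [~ x, z] y).
  by rewrite /m -addSn; apply: IHj => //; exact: lcs_comm.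
have := tact_tns_comm x y z; rewrite {3}/x conjgKV.
move/(congr1 (qmod m.+1)); rewrite qpiM tactM qpiM.
rewrite (qmod1 (tfil_tact _ a_m)) mulg1 !qmod_tact1 //; last exact: tfil_tact.
rewrite -{1}(mul1g (qmod _ _)) => /mulIg/esym/qpi_eq1; exact.
Qed.

Lemma tfil2 t : tfil 2 t.
Proof.
move: t; apply: (tensor_ind (tfil_subgroup 2)) => g h.
exact: (@tfil_tns 1 1 g h I I).
Qed.

Lemma lcs_commM i j x y : lcs i x -> lcs j y -> lcs (i + j) [~ x, y].
Proof. by move=> ix jy; rewrite -tdel_tns; apply: tfil_tdel; apply: tfil_tns. Qed.

Lemma qmod_tact k j g t : tfil k t -> lcs j g ->
  forall m, m <= k + j -> qmod m (tact g t) = qmod m t.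
Proof.
move=> kt jg m mkj; apply/esym/qpi_eq; rewrite /= -tns_del.
by apply: (tfil_leq mkj); apply: tfil_tns => //; exact: tfil_tdel.
Qed.

Lemma qmod_anti k x y : qmod k (tns y x) = (qmod k (tns x y))^-1.
Proof. by apply/esym/mulg1_eq; rewrite -qpiM qmod1 //; exact: tfil_sym. Qed.

(** The Jacobi identity of the graded object; it comes from expanding
    [tact z (x (x) y)] as the symbol of [x [x, z]] and [y [y, z]]. *)
Lemma qmod_jacobi i j l x y z : 0 < i -> 0 < j -> 0 < l ->
    lcs i x -> lcs j y -> lcs l z -> let m := (i + j + l).+1 in
  qmod m (tns [~ x, y] z) = qmod m (tns x [~ y, z]) * qmod m (tns [~ x, z] y).
Proof.
move=> i0 j0 l0 ix jy lz m; set t := tns x y; set a := [~ x, z]; set b := [~ y, z].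
have a_l : lcs (i + l) a by exact: lcs_commM.
have b_l : lcs (j + l) b by exact: lcs_commM.
have t_f : tfil (i + j) t by exact: tfil_tns.
have xb : tfil (i + (j + l)) (tns x b) by exact: tfil_tns.
have ab : tfil (i + l + (j + l)) (tns a b) by exact: tfil_tns.
have ay : tfil (i + l + j) (tns a y) by exact: tfil_tns.
have fixm g s k : tfil k s -> m.-1 <= k -> qmod m (tact g s) = qmod m s.
  by move=> ks mk; exact: (qmod_tact1 g (tfil_leq mk ks)).
have -> : qmod m (tns [~ x, y] z) = (qmod m t)^-1 * qmod m (tact z t).
  by rewrite -tdel_tns tns_del qpiM (morphgV (qpiM _)).
have -> : tact z t = tact a (tns x b) * tns a b * tact b (tact a t * tns a y).
  rewrite -(tact_tnsMl x a b) [x * a]mulgA mulgV mul1g; exact: tact_tns_comm.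
rewrite tactM !qpiM (qmod1 (tfil_leq _ ab)) ?mulg1; last by rewrite /m; lia.
rewrite (fixm _ _ _ xb) ?(fixm _ _ _ ay); [|by rewrite /m /=; lia..].
rewrite (qmod_tact (tfil_tact _ t_f) b_l); last by rewrite /m; lia.
rewrite (qmod_tact t_f a_l); last by rewrite /m; lia.
rewrite !mulgA; congr (_ * _); rewrite -mulgA -conjgE -(morphgJ (qpiM _)) tconj.
by rewrite (fixm _ _ _ xb) // /m /=; lia.
Qed.

End TensorFiltration.
(** * Lyndon commutators span the graded pieces *)

Section LyndonCommutators.
Import Order.TTheory Order.DefaultSeqLexiOrder.
Local Open Scope group_scope.
Context {d : Order.disp_t} {X : orderType d}.
Implicit Types (u v w : seq X).

Section LyndonCommutator.
Variables (H : groupType) (h : X -> H).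

(* The first argument bounds the recursion, which is on the length of [w]. *)
Fixpoint lcomm_rec (k : nat) w : H :=
  match k, w with
  | k'.+1, [:: x] => h x
  | k'.+1, _ :: _ => [~ lcomm_rec k' (lfac w), lcomm_rec k' (rfac w)]
  | _, _ => 1
  end.

Definition lcomm w : H := lcomm_rec (size w) w.

Lemma lcomm1 x : lcomm [:: x] = h x.
Proof. by []. Qed.

Lemma lcommE w : 1 < size w -> lcomm w = [~ lcomm (lfac w), lcomm (rfac w)].
Proof.
have irr m k u : size u <= m -> size u <= k -> lcomm_rec k u = lcomm_rec m u.
  elim: m k u => [|m IHm] [|k] [|x [|y u]] // um uk.
  have [lu ru _ _ _] := @size_fac _ _ [:: x, y & u] isT; rewrite [LHS]/= [RHS]/=.
  by congr [~ _, _]; apply: IHm; rewrite -ltnS; apply: leq_trans lu _ || apply: leq_trans ru _.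
move=> w1; have [lw rw _ _ _] := size_fac w1; rewrite /lcomm.
case: w w1 lw rw => [|x [|y w]] // _ lw rw.
rewrite -[LHS]/[~ lcomm_rec (size w).+1 (lfac [:: x, y & w]),
                   lcomm_rec (size w).+1 (rfac [:: x, y & w])].
by congr [~ _, _]; apply: irr.
Qed.

Lemma lcomm_lcs w : lcs (size w) (lcomm w).
Proof.
have [m] := ubnP (size w); elim: m w => // m IHm [|x [|y w]] // wm.
set u := [:: x, y & w] in wm *; have u1 : 1 < size u by [].
have [lu ru _ _ uE] := size_fac u1; rewrite lcommE // -uE.
by apply: lcs_commM; apply: IHm; [apply: leq_trans lu _|apply: leq_trans ru _].
Qed.
End LyndonCommutator.

Lemma lcomm_morph (H K : groupType) (h : X -> H) (f : H -> K) w :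
  {morph f : x y / x * y} -> f (lcomm h w) = lcomm (f \o h) w.
Proof.
move=> fM; have [m] := ubnP (size w); elim: m w => // m IHm [|x [|y w]] // wm.
  exact: morphg1 fM.
set u := [:: x, y & w] in wm *; have u1 : 1 < size u by [].
have [lu ru _ _ uE] := size_fac u1; rewrite (lcommE h u1) (lcommE _ u1) (morphgR fM).
by congr [~ _, _]; apply: IHm; [apply: leq_trans lu _|apply: leq_trans ru _].
Qed.
End LyndonCommutators.

Section Spanning.
Import Order.TTheory Order.DefaultSeqLexiOrder.
Local Open Scope group_scope.
Local Open Scope classical_set_scope.
Context {d : Order.disp_t} {X : orderType d}.
Implicit Types (u v w : seq X).
Variables (G : groupType) (h : X -> G).
Notation T := (tensor_square G).
Local Notation c := (lcomm h).

(** The symbol with boundary [lcomm h w], see [tdel_lspan]. *)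
Definition ltens w : T := tns (c (lfac w)) (c (rfac w)).

Definition lspan k (P : set (seq X)) : set T :=
  gen ([set t | exists w, [/\ lyndon w, size w = k, P w & t = ltens w]]
       `|` tfil k.+1).

Definition lcspan k (P : set (seq X)) : set G :=
  gen ([set g | exists w, [/\ lyndon w, size w = k, P w & g = c w]]
       `|` lcs k.+1).

Lemma lspan_subgroup k P : is_subgroup (lspan k P).
Proof. exact: gen_subgroup. Qed.

Lemma tfil_lspan k P : tfil k.+1 `<=` lspan k P.
Proof. by move=> t kt; apply: sub_gen; right. Qed.

Lemma lspan_sub k P Q : P `<=` Q -> lspan k P `<=` lspan k Q.
Proof.
move=> PQ; apply: gen_sub => t [[w [Lw wk Pw ->]]|]; last by right.
by left; exists w; split=> //; exact: PQ.
Qed.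

Lemma tdel_lspan k P t : 1 < k -> lspan k P t -> lcspan k P (tdel t).
Proof.
move=> k1; move: t; apply: (gen_min (B := @tdel G @^-1` lcspan k P)).
  exact: (preim_subgroup (@tdelM G) (gen_subgroup _)).
move=> t [[w [Lw wk Pw ->]]|kt]; apply: sub_gen; last by right; apply: tfil_tdel.
by left; exists w; split=> //; rewrite tdel_tns -lcommE ?wk.
Qed.

Lemma congr_subgroup m (S : set T) s t : is_subgroup S -> tfil m `<=` S ->
  qpi (tfil_nsub G m) s = qpi (tfil_nsub G m) t -> S t -> S s.
Proof.
move=> sS mS /esym/qpi_eq /mS Sts St.
by have := subgroupMl (t^-1 * s) sS St; rewrite mulVKg => ->.
Qed.

Lemma span_left i j (S : set T) (A : set G) y :
    is_subgroup S -> tfil (i + j).+1 `<=` S -> lcs j y -> A `<=` lcs i ->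
    (forall a, A a -> S (tns a y)) ->
  forall x, gen (A `|` lcs i.+1) x -> S (tns x y).
Proof.
move=> sS mS jy Ai AS x.
have sl := lcs_subgroup G i; have [l1 lM lV] := sl; have [S1 SM SV] := sS.
have S_tact g z : lcs i z -> S (tns z y) -> S (tact g (tns z y)).
  by move=> iz; apply: congr_subgroup mS _ => //; apply: qmod_tact1; apply: tfil_tns.
suff: gen (A `|` lcs i.+1) `<=` [set z | lcs i z /\ S (tns z y)] by move=> /(_ x) H /H [].
apply: gen_min => [|z [Az|iz]] /=; last 1 first.
- split; first exact: lcs_leq iz.
  by apply: mS; rewrite -addSn; apply: tfil_tns.
- split=> [|z z1 [iz Sz] [iz1 Sz1]|z [iz Sz]] /=; first by rewrite tns1g.
    by split; [exact: lM|rewrite tact_tnsMl; apply: SM => //; exact: S_tact].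
  by split; [exact: lV|rewrite tnsVl; apply: SV; exact: S_tact].
- by split; [exact: Ai|exact: AS].
Qed.

Lemma span_anti m (S : set T) x y : is_subgroup S -> tfil m `<=` S ->
  S (tns x y) -> S (tns y x).
Proof.
move=> sS mS; rewrite -(subgroupVE _ sS) => /(congr_subgroup sS mS); apply.
by rewrite qmod_anti (morphgV (qpiM _)).
Qed.

Lemma span_bilinear i j (S : set T) (A B : set G) :
    is_subgroup S -> tfil (i + j).+1 `<=` S -> A `<=` lcs i -> B `<=` lcs j ->
    (forall a b, A a -> B b -> S (tns a b)) ->
  forall x y, gen (A `|` lcs i.+1) x -> gen (B `|` lcs j.+1) y -> S (tns x y).
Proof.
move=> sS mS Ai Bj AB x y Ax By.
have jy : lcs j y.
  move: y By; apply: gen_min; first exact: lcs_subgroup.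
  by move=> z [/Bj|] //; apply: lcs_leq.
move: x Ax; apply: (span_left sS mS jy Ai) => a Aa; apply: (span_anti sS mS).
rewrite addnC in mS; move: y By {jy}; apply: (span_left sS mS (Ai _ Aa) Bj) => b Bb.
by apply: (span_anti sS mS); exact: AB.
Qed.

Lemma lcomm_sub k P :
  [set g | exists w, [/\ lyndon w, size w = k, P w & g = c w]] `<=` lcs k.
Proof. by move=> _ [w [_ <- _ ->]]; exact: lcomm_lcs. Qed.

(** Longer and longer words may decrease lexicographically for ever, but among
    words of bounded length a decreasing measure is available. *)
Hypothesis bounded_wf : forall k, exists wt : seq X -> nat,
  forall u v, size u <= k -> size v <= k -> (u < v)%O -> wt u < wt v.

(** The rewriting argument that Lyndon commutators are closed under brackets up
    to higher weight: unless [a ++ b] has standard factorization [(a, b)], the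
    Jacobi identity replaces [[a', a''], b] by brackets whose larger entry is
    smaller than [b]. *)
Lemma lspan_bracket k a b : lyndon a -> lyndon b -> (a < b)%O ->
  size a + size b = k -> lspan k [set w | (w < b)%O] (tns (c a) (c b)).
Proof.
elim/ltn_ind: k a b => k IHk a b.
have [wt wtP] := bounded_wf k; have [m] := ubnP (wt b).
elim: m a b => // m IHm a b bm La Lb ab abk.
set S := lspan k _.
have sS : is_subgroup S by exact: lspan_subgroup.
have kS : tfil k.+1 `<=` S by exact: tfil_lspan.
have size_gt0 u : lyndon u -> 0 < size u by case; case: u.
have below u v : lyndon u -> lyndon v -> size u + size v = k ->
    (u < b)%O -> (v < b)%O -> S (tns (c u) (c v)).
  have lt_case u' v' : lyndon u' -> lyndon v' -> size u' + size v' = k ->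
      (u' < v')%O -> (v' < b)%O -> S (tns (c u') (c v')).
    move=> Lu Lv uvk uv vb; apply: (@lspan_sub k [set w | (w < v')%O]).
      by move=> w /= wv; exact: lt_trans vb.
    apply: IHm => //; apply: leq_trans (_ : wt b <= m); last by [].
    apply: wtP => //; [rewrite -uvk|rewrite -abk]; exact: leq_addl.
  move=> Lu Lv uvk ub vb; case: (ltgtP u v) => [uv|vu|->].
  - exact: lt_case.
  - by apply: (span_anti sS kS); apply: lt_case; rewrite 1?addnC.
  - by apply: kS; exact: tfil_sq.
have [a1|a1] := leqP (size a) 1.
  have aE : size a = 1%N by apply/eqP; rewrite eqn_leq a1 size_gt0.
  apply: sub_gen; left; exists (a ++ b); split; first exact: lyndon_cat.
  - by rewrite size_cat.
  - exact: lyndon_cat_lt.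
  - by rewrite /ltens lfac_lyndon_cat ?rfac_lyndon_cat //; left.
have [le_b|lt_b] := leP b (rfac a).
  apply: sub_gen; left; exists (a ++ b); split; first exact: lyndon_cat.
  - by rewrite size_cat.
  - exact: lyndon_cat_lt.
  - by rewrite /ltens lfac_lyndon_cat ?rfac_lyndon_cat //; right.
have [Ll Lr] := (lyndon_lfac La a1, lyndon_rfac La a1).
have lr := lfac_lt_rfac La a1; have lb := lt_trans lr lt_b.
have [sl sr l0 r0 aE] := size_fac a1; have b0 := size_gt0 _ Lb.
rewrite (lcommE h a1); move: abk; rewrite -aE => abk.
set a' := lfac a in Ll lr lb l0 abk *; set a'' := rfac a in Lr lr lt_b r0 abk *.
apply: (congr_subgroup
  (t := tns (c a') [~ c a'', c b] * tns [~ c a', c b] (c a'')) sS kS).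
  rewrite -abk qpiM; apply: qmod_jacobi => //; exact: lcomm_lcs.
have [_ SM _] := sS; apply: SM.
- have k1 : size a'' + size b < k by rewrite -abk -addnA -[ltnLHS]add0n ltn_add2r.
  have := IHk _ k1 _ _ Lr Lb lt_b erefl.
  move/(tdel_lspan _); rewrite tdel_tns => /(_ (leq_add r0 b0)) Hg.
  move: (Hg); apply: (@span_bilinear (size a') _ S [set c a']) => //.
  + by rewrite addnA abk.
  + by move=> _ ->; exact: lcomm_lcs.
  + exact: lcomm_sub.
  + move=> _ _ -> [w [Lw wk wb ->]]; apply: below => //.
    by rewrite wk addnA.
  + by apply: sub_gen; left.
- have k1 : size a' + size b < k by rewrite -abk ltn_add2r -[ltnLHS]addn0 ltn_add2l.
  have := IHk _ k1 _ _ Ll Lb lb erefl.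
  move/(tdel_lspan _); rewrite tdel_tns => /(_ (leq_add l0 b0)) Hg.
  move: (Hg) (gen_sub); move=> Hg' _.
  apply: (@span_bilinear _ (size a'') S _ [set c a''] _ _ _ _ _ _ _ Hg') => //.
  + by rewrite addnAC abk.
  + exact: lcomm_sub.
  + by move=> _ ->; exact: lcomm_lcs.
  + move=> _ _ [w [Lw wk wb ->]] ->; apply: below => //.
    by rewrite wk addnAC.
  + by apply: sub_gen; left.
Qed.

Hypothesis h_gen : forall B : set G, is_subgroup B -> (forall x, B (h x)) ->
  forall g, B g.

(** Boundaries turn the spanning statement in weight [k] of the tensor square
    into the one for the lower central series, and bilinearity against the
    generators leads from there to weight [k.+1] of the tensor square. *)
Lemma tfil_lspanS k : lcs k.+1 `<=` lcspan k.+1 setT ->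
  tfil k.+2 `<=` lspan k.+2 setT.
Proof.
move=> IHk; have sS := lspan_subgroup k.+2 setT; have kS := @tfil_lspan k.+2 setT.
apply: gen_min => // t [[x [g [/IHk kx ->]]]|]; last first.
  by case=> [[g ->]|[g [g' ->]]]; apply: kS; [exact: tfil_sq|exact: tfil_sym].
have gspan : gen ([set g | exists w, [/\ lyndon w, size w = 1%N, setT w & g = c w]]
    `|` lcs 2) g.
  apply: h_gen => [|y]; first exact: gen_subgroup.
  by apply: sub_gen; left; exists [:: y]; split=> //; exact: lyndon1.
apply: (span_bilinear (i := k.+1) (j := 1) _ _ _ _ _ kx gspan); rewrite ?addn1 //.
- exact: lcomm_sub.
- move=> _ _ [u [Lu uk _ ->]] [v [Lv vk _ ->]].
  have uvk : size u + size v = k.+2 by rewrite uk vk addn1.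
  case: (ltgtP u v) => [uv|vu|->].
  + by apply: (lspan_sub (P := [set w | (w < v)%O])) => //; exact: lspan_bracket.
  + apply: (span_anti sS kS); apply: (lspan_sub (P := [set w | (w < u)%O])) => //.
    by apply: lspan_bracket => //; rewrite addnC.
  + by apply: kS; exact: tfil_sq.
Qed.

Lemma lcs_lcspan k : lcs k.+1 `<=` lcspan k.+1 setT.
Proof.
elim: k => [|k IHk].
  move=> g _; apply: h_gen => [|y]; first exact: gen_subgroup.
  by apply: sub_gen; left; exists [:: y]; split=> //; exact: lyndon1.
apply: lcs_ind => [|x g kx]; first exact: gen_subgroup.
rewrite -tdel_tns; apply: tdel_lspan => //; apply: (tfil_lspanS IHk).
by apply: sub_gen; left; exists x, g.
Qed.

Lemma tfil_span k : tfil k.+2 `<=` lspan k.+2 setT.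
Proof. by apply: tfil_lspanS; exact: lcs_lcspan. Qed.

End Spanning.
(** * The unitriangular group and its filtration *)

Section UnitriangularMatrices.
Import GRing.Theory.
Local Open Scope ring_scope.
Variables (R : nzRingType) (m : nat).
Local Notation M := 'M[R]_m.+1.
Implicit Types (A B : M) (i j r : 'I_m.+1) (k l : nat).

Definition mfil k A : Prop := forall i j, (j < i + k)%N -> A i j = 0.

Lemma mfilD k A B : mfil k A -> mfil k B -> mfil k (A + B).
Proof. by move=> kA kB i j ij; rewrite mxE kA // kB // addr0. Qed.

Lemma mfilN k A : mfil k A -> mfil k (- A).
Proof. by move=> kA i j ij; rewrite mxE kA // oppr0. Qed.

Lemma mfil0 k : mfil k 0.
Proof. by move=> i j _; rewrite mxE. Qed.

Lemma mfil1 : mfil 0 1.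
Proof.
move=> i j; rewrite addn0 => ji; rewrite mxE; case: eqP => // ij.
by rewrite ij ltnn in ji.
Qed.

Lemma mfilM k l A B : mfil k A -> mfil l B -> mfil (k + l) (A * B).
Proof.
move=> kA lB i j ij; rewrite mxE big1 // => r _.
have [ri|ir] := ltnP r (i + k); first by rewrite kA // mul0r.
rewrite lB ?mulr0 //; apply: leq_trans ij _.
by rewrite addnA leq_add2r.
Qed.

Lemma mfil_leq k l A : (l <= k)%N -> mfil k A -> mfil l A.
Proof.
by move=> lk kA i j ij; apply: kA; apply: leq_trans ij _; rewrite leq_add2l.
Qed.

Lemma mfil_eq0 k A : (m < k)%N -> mfil k A -> A = 0.
Proof.
move=> mk kA; apply/matrixP => i j; rewrite mxE kA //.
by apply: leq_trans (leq_trans (ltn_ord j) mk) _; exact: leq_addl.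
Qed.

Lemma mfilX A k : mfil 1 A -> mfil k (A ^+ k).
Proof.
move=> A1; elim: k => [|k IHk]; first by rewrite expr0; exact: mfil1.
by rewrite exprS -add1n; exact: mfilM.
Qed.

(** The first diagonal on which a product of filtered matrices can be nonzero. *)
Lemma mfilM_lead k l A B i r j : mfil k A -> mfil l B ->
  r = (i + k)%N :> nat -> j = (r + l)%N :> nat -> (A * B) i j = A i r * B r j.
Proof.
move=> kA lB rE jE; rewrite mxE (bigD1 r) //= big1 ?addr0 // => s sr.
have [si|] := ltnP s (i + k); first by rewrite kA // mul0r.
rewrite leq_eqVlt => /orP[/eqP si|is_].
  by case/eqP: sr; apply: val_inj; rewrite /= -si.
by rewrite lB ?mulr0 // jE ltn_add2r rE.
Qed.

Lemma mfil_upper A : mfil 1 (A - 1) -> mfil 0 A.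
Proof.
move=> A1; rewrite -[A](subrK 1); apply: mfilD mfil1.
exact: (@mfil_leq 1).
Qed.

Definition unitri_pair : pred (M * M) :=
  [pred p | [&& p.1 * p.2 == 1, p.2 * p.1 == 1, `[< mfil 1 (p.1 - 1) >]
              & `[< mfil 1 (p.2 - 1) >]]].

(** An element carries its inverse along, so that no theory of determinants
    over [R] is involved. *)
Definition unitri : Type := {p : M * M | unitri_pair p}.
HB.instance Definition _ := SubChoice.on unitri.

Implicit Types x y z : unitri.

Definition utm x : M := (val x).1.

Lemma unitriP x :
  [/\ utm x * (val x).2 = 1, (val x).2 * utm x = 1, mfil 1 (utm x - 1)
    & mfil 1 ((val x).2 - 1)].
Proof. by case/and4P: (valP x) => /eqP ? /eqP ? /asboolP ? /asboolP. Qed.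

Lemma mfil1M A B : mfil 1 (A - 1) -> mfil 1 (B - 1) -> mfil 1 (A * B - 1).
Proof.
move=> A1 B1; have -> : A * B - 1 = (A - 1) * B + (B - 1).
  by rewrite mulrBl mul1r addrA subrK.
by apply: mfilD => //; apply: (mfilM A1 (mfil_upper B1)).
Qed.

Lemma unitri1_subproof : unitri_pair (1, 1).
Proof. by rewrite /unitri_pair /= mulr1 eqxx subrr asboolT //; exact: mfil0. Qed.

Lemma unitriM_subproof x y :
  unitri_pair (utm x * utm y, (val y).2 * (val x).2).
Proof.
have [xV Vx x1 Vx1] := unitriP x; have [yV Vy y1 Vy1] := unitriP y.
rewrite /unitri_pair /= mulrA -(mulrA (utm x)) yV mulr1 xV eqxx.
rewrite mulrA -(mulrA (val y).2) Vx mulr1 Vy eqxx.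
by rewrite !asboolT //; exact: mfil1M.
Qed.

Lemma unitriV_subproof x : unitri_pair ((val x).2, utm x).
Proof.
by have [xV Vx x1 Vx1] := unitriP x; rewrite /unitri_pair /= xV Vx eqxx !asboolT.
Qed.

Definition unitri_one : unitri := exist (fun p => unitri_pair p) _ unitri1_subproof.
Definition unitri_mul x y : unitri :=
  exist (fun p => unitri_pair p) _ (unitriM_subproof x y).
Definition unitri_inv x : unitri :=
  exist (fun p => unitri_pair p) _ (unitriV_subproof x).

Lemma utm_inj : injective utm.
Proof.
move=> x y xy; apply: val_inj; rewrite [LHS]surjective_pairing.
rewrite [RHS]surjective_pairing -/(utm x) -/(utm y) xy; congr (_, _).
have [xV Vx _ _] := unitriP x; have [yV Vy _ _] := unitriP y.
by rewrite -[LHS]mulr1 -yV -xy mulrA Vx mul1r.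
Qed.

Lemma unitri_mulA : associative unitri_mul.
Proof. by move=> x y z; apply: utm_inj; rewrite /utm /= mulrA. Qed.

Lemma unitri_mul1 : left_id unitri_one unitri_mul.
Proof. by move=> x; apply: utm_inj; rewrite /utm /= mul1r. Qed.

Lemma unitri_mulr1 : right_id unitri_one unitri_mul.
Proof. by move=> x; apply: utm_inj; rewrite /utm /= mulr1. Qed.

Lemma unitri_mulV : left_inverse unitri_one unitri_inv unitri_mul.
Proof. by move=> x; apply: utm_inj; rewrite /utm /=; case: (unitriP x). Qed.

Lemma unitri_mulrV : right_inverse unitri_one unitri_inv unitri_mul.
Proof. by move=> x; apply: utm_inj; rewrite /utm /=; case: (unitriP x). Qed.

HB.instance Definition _ := isGroup.Build unitri
  unitri_mulA unitri_mul1 unitri_mulr1 unitri_mulV unitri_mulrV.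

Lemma utm1 : utm 1%g = 1.
Proof. by []. Qed.

Lemma utmM x y : utm (x * y)%g = utm x * utm y.
Proof. by []. Qed.

Lemma utmVK x : utm x^-1%g * utm x = 1.
Proof. by case: (unitriP x). Qed.

Lemma unitri_geom_subproof A :
  mfil 1 A -> unitri_pair (1 + A, \sum_(i < m.+1) (- A) ^+ i).
Proof.
move=> A1; set S := \sum_(_ < _) _.
have N0 : (- A) ^+ m.+1 = 0.
  by apply: (@mfil_eq0 m.+1) => //; apply: mfilX; exact: mfilN.
have S1 : (1 + A) * S = 1.
  have := subrX1 (- A) m.+1; rewrite N0 sub0r => /(congr1 -%R).
  by rewrite opprK -mulNr opprB opprK => <-.
have cS : GRing.comm A S.
  apply: commr_sum => i _; apply: commrX; exact/commrN/commr_refl.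
have A1' : mfil 1 (1 + A - 1) by rewrite addrAC subrr add0r.
have S1' : mfil 1 (S - 1).
  rewrite /S big_ord_recl expr0 addrAC subrr add0r.
  elim/big_ind: _ => [|B C B1 C1|i _]; [exact: mfil0|exact: mfilD|].
  by apply: (@mfil_leq (lift ord0 i)) => //; apply/mfilX/mfilN.
rewrite /unitri_pair /= S1 eqxx mulrDr mulr1 -cS -{1}(mul1r S) -mulrDl S1 eqxx.
by rewrite !asboolT.
Qed.

Definition unitri_geom A (A1 : mfil 1 A) : unitri :=
  exist (fun p => unitri_pair p) _ (unitri_geom_subproof A1).

Definition utfil k : set unitri := [set x | mfil k (utm x - 1)].

Lemma utfil_upper x : mfil 0 (utm x).
Proof.
by apply: mfil_upper; case: (unitriP x).
Qed.

Lemma utfil_weight1 x : utfil 1 x.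
Proof. by case: (unitriP x). Qed.

Lemma utfil_leq k l x : (l <= k)%N -> utfil k x -> utfil l x.
Proof. exact: mfil_leq. Qed.

Lemma utfil_subgroup k : is_subgroup (utfil k).
Proof.
split=> [|x y kx ky|x kx]; rewrite /utfil /=.
- by rewrite utm1 subrr; exact: mfil0.
- have -> : utm (x * y)%g - 1 = (utm x - 1) * utm y + (utm y - 1).
    by rewrite utmM mulrBl mul1r addrA subrK.
  by apply: mfilD => //; rewrite -[k]addn0; apply: mfilM kx (utfil_upper y).
- have -> : utm x^-1%g - 1 = - (utm x^-1%g * (utm x - 1)).
    by rewrite mulrBr utmVK mulr1 opprB.
  by apply: mfilN; rewrite -[k]add0n; apply: mfilM kx; exact: utfil_upper.
Qed.

Lemma utfil_eq1 k x : (m < k)%N -> utfil k x -> x = 1%g.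
Proof.
move=> mk kx; apply: utm_inj; apply/eqP; rewrite -subr_eq0 utm1.
by rewrite (mfil_eq0 mk kx).
Qed.

(** The group commutator is the ring commutator up to a unipotent factor, so
    both have the same leading diagonal. *)
Lemma utm_comm x y (a := utm x - 1) (b := utm y - 1) :
  utm [~ x, y]%g - 1 = utm (x^-1 * y^-1)%g * (a * b - b * a).
Proof.
have -> : a * b - b * a = utm (x * y)%g - utm (y * x)%g.
  have lin (p q r s e : M) : p - s - (r - e) - (q - r - (s - e)) = p - q.
    have E (u v w : M) : u - v - w = u - (v + w) by rewrite opprD addrA.
    by rewrite (E p s) (E q r) (addrCA r) opprB [_ + (_ - q)]addrA subrK.
  by rewrite !utmM /a /b !(mulrBr, mulr1) !(mulrBl, mul1r) lin.
rewrite mulrBr -!utmM.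
have -> : (x^-1 * y^-1 * (x * y) = [~ x, y])%g by rewrite commgEl conjgE !mulgA.
by have -> : (x^-1 * y^-1 * (y * x) = 1)%g by rewrite -mulgA mulKg mulVg.
Qed.

Lemma utfil_comm k l x y : utfil k x -> utfil l y -> utfil (k + l) [~ x, y]%g.
Proof.
move=> kx ly; rewrite /utfil /= utm_comm -[(k + l)%N]add0n.
apply: mfilM (utfil_upper _) _; apply: mfilD; first exact: mfilM.
by apply: mfilN; rewrite addnC; exact: mfilM.
Qed.

Lemma utfil_lcs (F : groupType) (f : F -> unitri) : {morph f : x y / (x * y)%g} ->
  forall k a, lcs k a -> utfil k (f a).
Proof.
move=> fM [|[|k]] a; first by move=> _; apply: utfil_leq (utfil_weight1 _).
  by move=> _; exact: utfil_weight1.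
move: a; elim: k => [|k IHk]; (apply: (@lcs_ind _ _ (f @^-1` utfil _)%classic);
  first exact: (preim_subgroup fM (utfil_subgroup _))) => a b ka.
  by rewrite /= (morphgR fM); exact: (utfil_comm (utfil_weight1 _) (utfil_weight1 _)).
rewrite /= (morphgR fM) -addn1; apply: utfil_comm (utfil_weight1 _); exact: IHk.
Qed.

Definition ent x (i j : nat) : R := utm x (inord i) (inord j).
Arguments ent x (i j)%_N.

Lemma ent_sub1 x (i j : nat) : (i < j <= m)%N ->
  ent x i j = (utm x - 1) (inord i) (inord j).
Proof.
move=> /andP[ij jm]; rewrite !mxE; case: eqP => [/(congr1 val)|_]; last first.
  by rewrite subr0.
have im : (i <= m)%N by exact: leq_trans (ltnW ij) jm.
by rewrite /= !inordK // => ij'; rewrite ij' ltnn in ij.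
Qed.

Lemma ent0 k x (i j : nat) : utfil k x -> (i < j <= m)%N -> (j < i + k)%N -> ent x i j = 0.
Proof.
move=> kx ijm jk; have /andP[ij jm] := ijm; have im : (i <= m)%N by exact: leq_trans (ltnW ij) jm.
by rewrite ent_sub1 // kx // !inordK.
Qed.

Lemma entM k x y (i : nat) : (0 < k)%N -> (i + k <= m)%N -> utfil k x -> utfil k y ->
  ent (x * y)%g i (i + k) = ent x i (i + k) + ent y i (i + k).
Proof.
move=> k0 ikm kx ky.
have ik : (i < i + k <= m)%N by rewrite -[ltnLHS]addn0 ltn_add2l k0.
rewrite !ent_sub1 //.
have -> : utm (x * y)%g - 1 = (utm x - 1) * (utm y - 1) + ((utm x - 1) + (utm y - 1)).
  by rewrite utmM mulrBr mulr1 mulrBl mul1r addrA subrK addrA subrK.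
rewrite mxE (mfilM kx ky) ?add0r; first by rewrite mxE.
rewrite !inordK //; first by rewrite addnA -[ltnLHS]addn0 ltn_add2l.
by rewrite ltnS (leq_trans _ ikm) // leq_addr.
Qed.

Lemma ent_comm k l x y (i : nat) : (0 < k)%N -> (0 < l)%N -> (i + (k + l) <= m)%N ->
    utfil k x -> utfil l y ->
  ent [~ x, y]%g i (i + (k + l)) =
    ent x i (i + k) * ent y (i + k) (i + (k + l)) -
    ent y i (i + l) * ent x (i + l) (i + (k + l)).
Proof.
move=> k0 l0 iklm kx ly.
have [ik il] : (i + k <= m /\ i + l <= m)%N by split; lia.
have im : (i <= m)%N by lia.
have lead (A B : M) p q : mfil p A -> mfil q B -> (p + q = k + l)%N ->
    (A * B) (inord i) (inord (i + (k + l))) =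
    A (inord i) (inord (i + p)) * B (inord (i + p)) (inord (i + (k + l))).
  by move=> pA qB pq; apply: mfilM_lead pA qB _ _; rewrite !inordK; lia.
rewrite ent_sub1 ?utm_comm; last by lia.
set a := utm x - 1; set b := utm y - 1.
have abf : mfil (k + l) (a * b - b * a).
  by apply: mfilD; [|apply: mfilN; rewrite addnC]; exact: mfilM.
rewrite (lead _ _ 0 (k + l))%N //; last exact: utfil_upper.
rewrite addn0 -[X in X * _](subrK (1 : R)).
have -> : utm (x^-1 * y^-1)%g (inord i) (inord i) - 1 =
    (utm (x^-1 * y^-1)%g - 1) (inord i) (inord i) by rewrite !mxE eqxx.
rewrite (utfil_weight1 (x^-1 * y^-1)%g) ?addn1 // add0r mul1r mxE (lead a b k l) //.
rewrite [in X in _ + X]mxE (lead b a l k) //; last by rewrite addnC.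
by rewrite -!ent_sub1 //; lia.
Qed.

End UnitriangularMatrices.
(** * Lowest terms of Lyndon commutators of generic matrices *)

Section WordValue.
Import Order.TTheory Order.DefaultSeqLexiOrder.
Context {d : Order.disp_t} {X : orderType d}.
Variables (B : nat) (dig : X -> nat).
Hypothesis dig_lt : forall x y : X, (x < y)%O -> dig x < dig y.
Hypothesis dig_gt0 : forall x, 0 < dig x.
Hypothesis dig_B : forall x, dig x < B.
Implicit Types u v : seq X.

(** A word read in base [B], padded on the right to [m] digits. *)
Fixpoint wval m u : nat :=
  match m, u with
  | m'.+1, x :: u' => dig x * B ^ m' + wval m' u'
  | _, _ => 0
  end.

Lemma wval_nil m : wval m [::] = 0.
Proof. by case: m. Qed.

Lemma wval_cat m u v : wval m (u ++ v) = wval m u + wval (m - size u) v.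
Proof.
elim: m u => [|m IHm] [|x u] //=.
by rewrite IHm subSS addnA.
Qed.

Lemma wval_bound (x : X) m u : wval m u < B ^ m.
Proof.
have B0 : 0 < B by exact: leq_ltn_trans (dig_B x).
elim: m u => [|m IHm] [|y u] //=; first by rewrite expn_gt0 B0.
apply: (@leq_trans ((dig y).+1 * B ^ m)).
  by rewrite mulSn addnC ltn_add2r.
by rewrite expnS leq_mul2r dig_B orbT.
Qed.

Lemma wval_lt m u v : (u < v)%O -> size u <= m -> size v <= m ->
  wval m u < wval m v.
Proof.
elim: m u v => [|m IHm] u v; first by rewrite !leqn0 => uv /nilP uE /nilP vE; rewrite uE vE in uv.
case: v => [|y v]; first by case: u.
have B0 : 0 < B by exact: leq_ltn_trans (dig_B y).
case: u => [|x u] /=; first by rewrite addn_gt0 muln_gt0 dig_gt0 expn_gt0 B0.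
rewrite !ltnS ltxi_cons => /andP[le_xy /implyP uv] um vm.
have [xy|yx] := ltP x y; last first.
  have -> : x = y by apply/eqP; rewrite eq_le le_xy.
  by rewrite ltn_add2l; apply: IHm => //; exact: uv.
apply: (@leq_trans ((dig x).+1 * B ^ m)).
  by rewrite mulSn addnC ltn_add2r (wval_bound x).
apply: leq_trans (leq_addr _ _).
by rewrite leq_mul2r (dig_lt xy) orbT.
Qed.
End WordValue.

Section LowestTerms.
Import GRing.Theory.
Local Open Scope ring_scope.
Implicit Types p q : {poly int}.

(** [p = 'X^e] up to terms of higher degree. *)
Definition lowest e p : Prop := (forall r, (r < e)%N -> p`_r = 0) /\ p`_e = 1.

Lemma lowestXn e : lowest e 'X^e.
Proof. by split=> [r re|]; rewrite coefXn ?eqxx // ltn_eqF. Qed.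

Lemma lowestM e f p q : lowest e p -> lowest f q -> lowest (e + f) (p * q).
Proof.
move=> [p0 p1] [q0 q1]; split=> [r ref|].
  rewrite coefM big1 // => i _; have [ie|ei] := ltnP i e.
    by rewrite p0 // mul0r.
  rewrite [q`_ _]q0 ?mulr0 //; have := ltn_ord i; rewrite ltnS => ir; lia.
have le : (e < (e + f).+1)%N by rewrite ltnS leq_addr.
rewrite coefM (bigD1 (Ordinal le)) //= p1 mul1r addKn q1 big1 ?addr0 // => i ie.
have ne : (nat_of_ord i != e) by apply: contraNN ie => /eqP ie; apply/eqP/val_inj.
have [lt|] := ltnP i e; first by rewrite p0 // mul0r.
rewrite leq_eqVlt eq_sym (negPf ne) /= => lt.
by rewrite [q`_ _]q0 ?mulr0 //; have := ltn_ord i; lia.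
Qed.

Lemma lowestB e f p q : lowest e p -> lowest f q -> (e < f)%N -> lowest e (p - q).
Proof.
move=> [p0 p1] [q0 _] ef; split=> [r re|]; rewrite coefB.
  by rewrite p0 // q0 ?subr0 //; exact: ltn_trans ef.
by rewrite p1 q0 ?subr0.
Qed.

End LowestTerms.

Section GenericMatrices.
Import GRing.Theory Order.TTheory Order.DefaultSeqLexiOrder.
Local Open Scope ring_scope.
Context {d : Order.disp_t} {X : orderType d}.
Variables (B : nat) (dig : X -> nat) (m : nat).
Hypothesis dig_lt : forall x y : X, (x < y)%O -> (dig x < dig y)%N.
Hypothesis dig_gt0 : forall x, (0 < dig x)%N.
Hypothesis dig_B : forall x, (dig x < B)%N.
Local Notation U := (unitri {poly int} m).

Definition superdiag (x : X) : 'M[{poly int}]_m.+1 :=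
  \matrix_(i, j) if j == i.+1 :> nat then 'X^(dig x * B ^ (m - i.+1)) else 0.

Lemma mfil_superdiag x : mfil 1 (superdiag x).
Proof. by move=> i j ij; rewrite mxE; case: eqP => // E; rewrite E addn1 ltnn in ij. Qed.

(** The exponents on the superdiagonal are chosen so that the entry met at
    position [i] along a word contributes the digit of weight [m - i - 1]. *)
Definition letter_mx (x : X) : U := unitri_geom (mfil_superdiag x).

Lemma ent_letter x i : (i < m)%N -> ent (letter_mx x) i i.+1 =
  'X^(dig x * B ^ (m - i.+1)).
Proof.
move=> im; rewrite /ent /utm /= !mxE !inordK ?eqxx //; last exact: ltnW.
case: eqP => [/(congr1 val)|_]; last by rewrite add0r.
by rewrite /= !inordK // => [/eqP|]; [rewrite ltn_eqF|exact: ltnW].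
Qed.

(** For a Lyndon word [w = u v] one has [u v < v <= v u], so the lowest term of
    the product along [u v] survives in the commutator. *)
Lemma lowest_lcomm w i : lyndon w -> (i + size w <= m)%N ->
  lowest (wval B dig (m - i) w) (ent (lcomm letter_mx w) i (i + size w)%N).
Proof.
have [k] := ubnP (size w); elim: k w i => // k IHk w i wk Lw iw.
have w0 : (0 < size w)%N by case: Lw; case: (w).
have [w1|w1] := leqP (size w) 1.
  case: w w0 w1 Lw iw {wk} => [|x [|y w]] // _ _ _; rewrite addn1 => im.
  rewrite lcomm1 ent_letter //; have -> : (m - i = (m - i.+1).+1)%N by lia.
  by rewrite /= wval_nil addn0; exact: lowestXn.
have [sl sr l0 r0 wE] := size_fac w1.
have [Ll Lr] := (lyndon_lfac Lw w1, lyndon_rfac Lw w1).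
have lr := lfac_lt_rfac Lw w1.
rewrite (lcommE _ w1) -wE -[wval _ _ _ w](congr1 (wval B dig _) (fac_cat w)) wval_cat.
have lcommU u : utfil (size u) (lcomm letter_mx u).
  exact: (utfil_lcs (f := id) (fun _ _ => erefl) (lcomm_lcs letter_mx u)).
rewrite ent_comm //; last by rewrite wE.
have [ia ib iab iba] : [/\ i + size (lfac w) <= m, i + size (rfac w) <= m,
    i + size (lfac w) + size (rfac w) <= m & i + size (rfac w) + size (lfac w) <= m]%N.
  by move: iw; rewrite -wE; move: (size _) (size _) => a b; split; lia.
have [la lb] : (size (lfac w) < k /\ size (rfac w) < k)%N.
  by split; [exact: leq_trans sl _|exact: leq_trans sr _].
have [ab ba] : (size (lfac w ++ rfac w) <= m - i /\ size (rfac w ++ lfac w) <= m - i)%N.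
  by move: iab iba; rewrite !size_cat; move: (size _) (size _) => a b; split; lia.
apply: lowestB; [apply: lowestM; first exact: IHk|apply: lowestM; first exact: IHk|].
- by rewrite -subnDA addnA; apply: IHk.
- by rewrite [(size (lfac w) + _)%N]addnC addnA; apply: IHk.
rewrite subnDA -!wval_cat; apply: wval_lt => //.
by apply: lt_le_trans (lyndon_cat_lt Ll Lr lr) (ltW (ltxi_catr _ _)); case: Ll.
Qed.

End GenericMatrices.
(** * Elements with independent lowest terms *)

Section Independence.
Import GRing.Theory.
Local Open Scope ring_scope.
Local Open Scope classical_set_scope.
Variables (H : groupType) (D K : set H) (f : H -> {poly int}) (A : nat -> set H)
  (b : nat).
Local Open Scope group_scope.
Hypotheses (sD : is_subgroup D) (sK : is_subgroup K) (KD : K `<=` D).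
Hypothesis AD : forall r, A r `<=` D.
Hypothesis fM : forall x y, D x -> D y -> f (x * y) = (f x + f y)%R.
Hypothesis fK : forall x, K x -> f x = 0%R.
Hypothesis A_inj : forall r s s', A r s -> A r s' -> s = s'.
Hypothesis A_low : forall r s, A r s -> forall i, (i < r)%N -> ((f s)`_i)%R = 0%R.
Hypothesis A_lead : forall r s, A r s -> ((f s)`_r)%R != 0%R.
Hypothesis A_central : forall r s x, A r s -> D x -> K [~ x, s].
Hypothesis A_bound : forall r s, A r s -> (r < b)%N.

Let S q : set H := gen ([set s | exists2 r, (q <= r)%N & A r s] `|` K).

Let SD q : S q `<=` D.
Proof. by apply: gen_min sD _ => s [[r _]|]; [exact: AD|exact: KD]. Qed.

Let KS q : K `<=` S q.
Proof. by move=> x Kx; apply: sub_gen; right. Qed.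

Let f1 : f 1 = 0%R.
Proof. by case: sK => K1 _ _; exact: fK. Qed.

Let fV x : D x -> f x^-1 = (- f x)%R.
Proof.
move=> Dx; apply/eqP; rewrite -addr_eq0 -fM ?mulVg ?f1 //.
by case: sD => _ _; exact.
Qed.

Let coefS q t : S q.+1 t -> ((f t)`_q)%R = 0%R.
Proof.
have [D1 DM DV] := sD.
suff: S q.+1 `<=` [set t | D t /\ ((f t)`_q)%R = 0%R] by move=> /(_ t) E /E [].
apply: gen_min => [|s [[r qr Ars]|Ks]] /=.
- split=> [|x y [Dx x0] [Dy y0]|x [Dx x0]] /=; first by rewrite f1 coef0.
    by split; [exact: DM|rewrite fM // coefD x0 y0 addr0].
  by split; [exact: DV|rewrite fV // coefN x0 oppr0].
- by split; [exact: AD Ars|exact: A_low Ars _ qr].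
- by split; [exact: KD|rewrite fK // coef0].
Qed.

Let central_mod : is_subgroup [set y | D y /\ forall x, D x -> K [~ x, y]].
Proof.
have [[D1 DM DV] [K1 KM KV]] := (sD, sK).
split=> [|y z [Dy Ky] [Dz Kz]|y [Dy Ky]] /=.
- by split=> // x _; rewrite commg1.
- split=> [|x Dx]; first exact: DM.
  have -> : [~ x, y * z] = [~ x, z] * [~ x, y] ^ z by rewrite conjRg comm_mulr.
  apply: (KM _ _ (Kz _ Dx)); have Kk := Ky _ Dx.
  by rewrite -(mulVKg [~ x, y] (_ ^ z)) -commgEl; apply: KM => //; apply/Kz/KD.
- split=> [|x Dx]; first exact: DV.
  have DJ : D (x ^ y^-1) by rewrite conjgE invgK; apply: (DM _ _ Dy); apply: (DM _ _ Dx); exact: DV.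
  suff -> : [~ x, y^-1] = [~ x ^ y^-1, y]^-1 by apply: KV; exact: Ky.
  by rewrite !commgEl conjgKV invgM invgK.
Qed.

Let step q t : S q t -> f t = 0%R -> S q.+1 t.
Proof.
have [[D1 DM DV] [K1 KM KV]] := (sD, sK).
have [S1 SM SV] := gen_subgroup ([set s | exists2 r, (q.+1 <= r)%N & A r s] `|` K).
rewrite -/(S q.+1) in S1 SM SV.
(* Either there is no generator in degree [q], or [S q] is [<s> * S q.+1]. *)
have [[s As]|noA] := pselect (exists s, A q s); last first.
  move=> + _; apply: gen_sub => x [[r qr Arx]|]; last by right.
  left; exists r => //; move: qr; rewrite leq_eqVlt => /orP[/eqP qr|//].
  by case: noA; exists x; rewrite qr.
have Ds := AD As.
pose C := [set y | [/\ D y, forall x, D x -> K [~ x, y]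
                     & exists i j, y * s ^+ i = s ^+ j]].
have sC : is_subgroup C.
  have [c1 cM cV] := central_mod.
  split=> [|y z [Dy Ky [i [j E]]] [Dz Kz [k [l E']]]|y [Dy Ky [i [j E]]]].
  - by have [? ?] := c1; split=> //; exists 0%N, 0%N; rewrite mulg1.
  - have [? ?] := cM y z (conj Dy Ky) (conj Dz Kz); split=> //.
    exists (k + i)%N, (j + l)%N.
    rewrite expgnDr -mulgA (mulgA z) E' -expgnDr addnC expgnDr mulgA E.
    by rewrite -expgnDr.
  - have [? ?] := cV y (conj Dy Ky); split=> //.
    by exists j, i; rewrite -E mulKg.
have C_S y x : C y -> S q.+1 x -> S q.+1 (x ^ y).
  move=> [Dy Ky _] Sx; rewrite -(mulVKg x (x ^ y)) -commgEl.
  by apply: SM => //; apply: KS; apply: Ky; exact: SD Sx.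
have [c1 cM cV] := sC.
have decomp : S q `<=` [set t | exists y t', [/\ C y, S q.+1 t' & t = y * t']].
  apply: gen_min => [|x [[r qr Arx]|Kx]] /=; last first.
  - by exists 1, x; split; rewrite ?mul1g //; exact: KS.
  - move: qr; rewrite leq_eqVlt => /orP[/eqP qr|qr].
      exists s, 1; split; rewrite ?mulg1 //; last first.
        by apply: (A_inj _ As); rewrite qr.
      split=> // [x' Dx'|]; first exact: A_central As _.
      by exists 0%N, 1%N; rewrite mulg1.
    by exists 1, x; split; rewrite ?mul1g //; apply: sub_gen; left; exists r.
  - split=> [|_ _ [y [x [Cy Sx ->]]] [y' [x' [Cy' Sx' ->]]]|_ [y [x [Cy Sx ->]]]].
    + by exists 1, 1; split; rewrite ?mulg1.
    + exists (y * y'), (x ^ y' * x'); split; first exact: cM.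
        by apply: SM => //; exact: C_S.
      by rewrite conjgE !mulgA mulgK.
    + exists y^-1, ((x^-1) ^ y^-1); split; first exact: cV.
        by apply: C_S; [exact: cV|exact: SV].
      by rewrite invgM conjgE invgK mulKg.
move=> /decomp [y [x [[Dy _ [i [j E]]] Sx ->]]] f0.
have fX k : f (s ^+ k) = (f s *+ k)%R.
  elim: k => [|k IHk]; first by rewrite f1.
  rewrite expgS fM ?IHk ?mulrS //.
  by elim: k {IHk} => [//|k IHk]; rewrite expgS; exact: DM.
have DX k : D (s ^+ k) by elim: k => [//|k IHk]; rewrite expgS; exact: DM.
(* The degree [q] coefficient sees only the power of [s]. *)
have yq : ((f y)`_q)%R = 0%R.
  by move/(congr1 (fun p : {poly int} => (p`_q)%R)): f0;
     rewrite fM ?coefD ?(coefS Sx) ?addr0 ?coef0 //; exact: SD Sx.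
have ij : i = j.
  move/(congr1 (fun z => ((f z)`_q)%R)): E; rewrite fM // coefD yq add0r !fX !coefMn.
  rewrite -[(_ *+ i)%R]mulr_natr -[(_ *+ j)%R]mulr_natr => /(mulfI (A_lead As)).
  by rewrite !natz => -[].
suff -> : y = 1 by rewrite mul1g.
by apply: (mulIg (s ^+ i)); rewrite E mul1g ij.
Qed.

(** As the [f s] with [s] in [A r] have their lowest terms in distinct degrees
    [r], the generators are stripped off [t] one degree at a time. *)
Lemma lowest_term_indep t :
  gen ([set s | exists r, A r s] `|` K) t -> f t = 0%R -> K t.
Proof.
move=> At f0; have St q : S q t.
  elim: q => [|q IHq]; last exact: step.
  by move: At; apply: gen_sub => s [[r Ars]|]; [left; exists r|right].
move: (St b); move: t {At f0 St}; apply: (gen_min sK) => s [[r br Ars]|//].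
by have := leq_ltn_trans br (A_bound Ars); rewrite ltnn.
Qed.

End Independence.
(** * The representation over integer polynomials *)

Definition additive_group (V : zmodType) : Type := V.

Section AdditiveGroup.
Variable V : zmodType.
HB.instance Definition _ := Choice.on (additive_group V).
HB.instance Definition _ := isGroup.Build (additive_group V)
  (@GRing.addrA V) (@GRing.add0r V) (@GRing.addr0 V) (@GRing.addNr V) (@GRing.addrN V).
End AdditiveGroup.

Section Representation.
Import GRing.Theory Order.TTheory Order.DefaultSeqLexiOrder.
Local Open Scope group_scope.
Local Open Scope classical_set_scope.
Variables (n c : nat).
Hypothesis c_gt0 : 0 < c.
Local Notation F := (free_group 'I_n).
Local Notation N := (lcs_nsub F c.+1).
Local Notation G := (free_nilpotent n c).
Local Notation T := (tensor_square G).
Local Notation U := (unitri {poly int} c.+1).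
Local Notation base := (3 ^ n)%N.
Local Notation pr := (qpi N : F -> G).

(** Powers of three serve twice: they increase, and the sums of two of them are
    all different (see [xexp_inj]). *)
Definition dig (i : 'I_n) : nat := (3 ^ i)%N.

Lemma dig_lt (i j : 'I_n) : (i < j)%O -> dig i < dig j.
Proof. by rewrite ltEord => ij; rewrite ltn_exp2l. Qed.

Lemma dig_gt0 i : 0 < dig i.
Proof. by rewrite expn_gt0. Qed.

Lemma dig_base i : dig i < base.
Proof. by rewrite ltn_exp2l. Qed.

Definition xgen (i : 'I_n) : G := pr (free_gen i).

Lemma xgen_ind (B : set G) : is_subgroup B -> (forall i, B (xgen i)) ->
  forall g, B g.
Proof.
move=> sB Bx g; rewrite -(qpiK g); move: (repr g).
apply: (free_group_ind (B := pr @^-1` B)) => //.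
exact: (preim_subgroup (qpiM N) sB).
Qed.

Lemma lcs_class (x : G) : lcs c.+1 x -> x = 1.
Proof. by case/lcs_qpi => a la <-; apply/qpi_eq1. Qed.

Definition mu : F -> U := free_lift (letter_mx base dig c.+1).

Lemma muM : {morph mu : a b / a * b}.
Proof. exact: free_liftM. Qed.

Lemma mu_lcomm w : mu (lcomm (@free_gen _) w) = lcomm (letter_mx base dig c.+1) w.
Proof.
rewrite (lcomm_morph _ _ muM); congr (lcomm _ w); apply/funext => i /=.
exact: free_lift_gen.
Qed.

Lemma mu_repr (a : F) : exists2 z, utfil c.+1 z & mu (repr (pr a)) = mu a * z.
Proof.
have : normal_set N (a^-1 * repr (pr a)) by apply/qpi_eq; rewrite qpiK.
move/(utfil_lcs muM) => az; exists (mu (a^-1 * repr (pr a))) => //.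
by rewrite -muM mulVKg.
Qed.

Lemma mu_repr_lcs k (x : G) : k <= c.+1 -> lcs k x -> utfil k (mu (repr x)).
Proof.
move=> kc /lcs_qpi[a ka <-]; have [z zc ->] := mu_repr a.
have [_ UM _] := @utfil_subgroup {poly int} c.+1 k.
by apply: UM; [exact: (utfil_lcs muM)|exact: utfil_leq kc zc].
Qed.

Lemma utfil_central (x z : U) : utfil c.+1 z -> commute x z.
Proof.
move=> zc; apply/commgP/eqP; apply: (@utfil_eq1 _ _ c.+2) => //.
exact: (utfil_comm (utfil_weight1 x) zc).
Qed.

(** [mu] is only well defined on [G] modulo the central subgroup [utfil c.+1],
    which commutators do not see; this is what gains one nilpotency class. *)
Definition mu_comm (g h : G) : U := [~ mu (repr g), mu (repr h)].

Lemma mu_commE a b : mu_comm (pr a) (pr b) = [~ mu a, mu b].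
Proof.
have commMz (x y z : U) : utfil c.+1 z -> [~ x * z, y] = [~ x, y].
  move=> zc; have Z u : commute u z := utfil_central u zc.
  rewrite !commgEl conjMg invgM [z ^ y]conjgE -(Z y) mulKg.
  by rewrite -mulgA (mulgA x^-1) Z mulKg.
have [z zc za] := mu_repr a; have [z' zc' zb] := mu_repr b.
by rewrite /mu_comm za zb commMz // -invgR commMz // invgR.
Qed.

Definition rep : T -> U := tensor_lift mu_comm.

Lemma mu_comm_mull g g1 h :
  mu_comm (g * g1) h = mu_comm (g ^ g1) (h ^ g1) * mu_comm g1 h.
Proof.
rewrite -(qpiK g) -(qpiK g1) -(qpiK h) -!(morphgJ (qpiM N)) -qpiM !mu_commE.
by rewrite muM !(morphgJ muM) comm_mull.
Qed.

Lemma mu_comm_mulr g h h1 :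
  mu_comm g (h * h1) = mu_comm g h1 * mu_comm (g ^ h1) (h ^ h1).
Proof.
rewrite -(qpiK g) -(qpiK h1) -(qpiK h) -!(morphgJ (qpiM N)) -qpiM !mu_commE.
by rewrite muM !(morphgJ muM) comm_mulr.
Qed.

Lemma repM : {morph rep : s t / s * t}.
Proof. exact: tensor_liftM mu_comm_mull mu_comm_mulr. Qed.

Lemma rep_tns g h : rep (tns g h) = mu_comm g h.
Proof. exact: tensor_lift_tns mu_comm_mull mu_comm_mulr _ _. Qed.

Lemma rep_sym t : symmetric_symbols t -> rep t = 1.
Proof.
case=> [[g ->]|[g [h ->]]]; first by rewrite rep_tns /mu_comm commgg.
by rewrite repM !rep_tns /mu_comm -(invgR (mu (repr g))) mulgV.
Qed.

Lemma rep_tfil k t : k <= c.+2 -> tfil k t -> utfil k (rep t).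
Proof.
move=> kc; move: t; have sU := @utfil_subgroup {poly int} c.+1 k.
apply: (gen_min (B := rep @^-1` utfil k)); first exact: (preim_subgroup repM sU).
move=> t [[x [g [kx ->]]]|st] /=; last by rewrite rep_sym //; case: sU.
rewrite rep_tns /mu_comm; apply: (@utfil_leq _ _ (k.-1 + 1)).
  by rewrite addn1 leqSpred.
apply: utfil_comm (utfil_weight1 _); apply: mu_repr_lcs => //.
by case: (k) kc.
Qed.

Lemma rep_ltens w : 1 < size w ->
  rep (ltens xgen w) = lcomm (letter_mx base dig c.+1) w.
Proof.
move=> w1; rewrite rep_tns -[xgen]/(pr \o @free_gen _) -!(lcomm_morph _ _ (qpiM N)).
by rewrite mu_commE !mu_lcomm -lcommE.
Qed.

Lemma bounded_words_wf k : exists wt : seq 'I_n -> nat,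
  forall u v, size u <= k -> size v <= k -> (u < v)%O -> wt u < wt v.
Proof.
exists (wval base dig k) => u v uk vk uv.
exact: (wval_lt dig_lt dig_gt0 dig_base).
Qed.

Lemma comm_tfil k (s t : T) : tfil k t -> tfil k.+1 [~ t, s].
Proof.
move=> kt; rewrite commgEl tconj; apply/(qpi_eq (tfil_nsub G k.+1)).
by rewrite qmod_tact1.
Qed.

(** Modulo weight [k.+1] the elements of weight [k] are products of Lyndon
    symbols, whose images have independent entries at [(0, k)]. *)
Lemma rep_ker_step k t : 1 < k <= c.+1 -> tfil k t -> rep t = 1 -> tfil k.+1 t.
Proof.
case: k => [|[|k]] //; rewrite [1 < _]/=; set K := k.+2 => Kc Kt t1.
pose A r : set T := [set s | exists w, [/\ lyndon w, size w = K,
  wval base dig c.+1 w = r & s = ltens xgen w]].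
pose f t := ent (rep t) 0 K.
have fE s w : size w = K -> s = ltens xgen w ->
    f s = ent (lcomm (letter_mx base dig c.+1) w) 0 (0 + size w).
  by move=> wK ->; rewrite /f rep_ltens wK.
have low r s : A r s -> lowest r (f s).
  move=> [w [Lw wK <- sE]]; rewrite (fE _ _ wK sE).
  have := @lowest_lcomm _ _ base dig c.+1 dig_lt dig_gt0 dig_base w 0 Lw.
  by rewrite subn0; apply; rewrite wK.
have AD r : A r `<=` tfil K.
  move=> _ [w [Lw wK _ ->]]; have w1 : 1 < size w by rewrite wK.
  have [_ _ _ _ wE] := size_fac w1; rewrite -wK -wE.
  by apply: tfil_tns; exact: lcomm_lcs.
apply: (lowest_term_indep (D := tfil K) (f := f) (A := A) (b := (base ^ c.+1)%N)).
- exact: tfil_subgroup.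
- exact: tfil_subgroup.
- exact: tfil_leq.
- exact: AD.
- move=> x y Kx Ky; rewrite /f repM; apply: (entM (i := 0)) => //.
    by apply: rep_tfil Kx; exact: leqW.
  by apply: rep_tfil Ky; exact: leqW.
- by move=> x Kx; apply: (ent0 (k := K.+1)) => //; exact: rep_tfil.
- move=> r _ _ [w [Lw wK wr ->]] [v [Lv vK vr ->]].
  case: (ltgtP w v) => [wv|vw|-> //].
    have := wval_lt dig_lt dig_gt0 dig_base (m := c.+1) wv.
    by rewrite wK vK wr vr ltnn => /(_ Kc Kc).
  have := wval_lt dig_lt dig_gt0 dig_base (m := c.+1) vw.
  by rewrite wK vK wr vr ltnn => /(_ Kc Kc).
- by move=> r s /low[].
- by move=> r s /low[_ ->]; exact: oner_neq0.
- by move=> r s x _; exact: comm_tfil.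
- by move=> r _ [[|x w] [_ // _ <- _]]; exact: (wval_bound dig_base x).
- have := tfil_span bounded_words_wf xgen_ind Kt; apply: gen_sub => s.
  case=> [[w [Lw wK _ ->]]|]; last by right.
  by left; exists (wval base dig c.+1 w), w.
- rewrite /f t1; case: (@utfil_subgroup {poly int} c.+1 c.+2) => U1 _ _.
  exact: (ent0 (i := 0) U1).
Qed.

Lemma rep_ker t : rep t = 1 -> gen (@symmetric_symbols G) t.
Proof.
move=> t1; have : tfil c.+2 t.
  have H k : k <= c -> tfil k.+2 t.
    elim: k => [|k IHk] kc; first exact: tfil2.
    by apply: rep_ker_step => //; apply: IHk; exact: ltnW.
  exact: H.
move: t {t1}; apply: gen_min; first exact: gen_subgroup.
move=> t [[x [g [/lcs_class-> ->]]]|]; last exact: sub_gen.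
by rewrite tns1g; exact: gen1.
Qed.

Definition ell (g : G) : {poly int} := ent (mu (repr g)) 0 1.

Lemma ell_pr a : ell (pr a) = ent (mu a) 0 1.
Proof.
have [z zc E] := mu_repr a; rewrite /ell E (entM (k := 1) (i := 0)) //; last 2 first.
- exact: utfil_weight1.
- exact: utfil_weight1.
have z2 : utfil 2 z by apply: utfil_leq zc.
by rewrite (ent0 (i := 0) (j := 1) z2) ?addr0.
Qed.

Lemma ellM g h : ell (g * h) = (ell g + ell h)%R.
Proof.
rewrite -(qpiK g) -(qpiK h) -qpiM !ell_pr muM.
by apply: (entM (i := 0)) => //; exact: utfil_weight1.
Qed.

Lemma ellJ g h : ell (g ^ h) = ell g.
Proof.
apply: (addrI (ell h)); rewrite -ellM -conjgC ellM; exact: addrC.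
Qed.

(** As [ell] is the generic linear form on the abelianization of [G], this is
    the projection of the tensor square onto the symmetric square of the
    abelianization. *)
Definition sig : T -> additive_group {poly int} :=
  tensor_lift (H := additive_group {poly int}) (fun g h => ell g * ell h)%R.

Fact sig_mull g g1 h : (ell (g * g1)%g * ell h =
  ell (g ^ g1)%g * ell (h ^ g1)%g + ell g1 * ell h)%R.
Proof. by rewrite ellM !ellJ mulrDl. Qed.

Fact sig_mulr g h h1 : (ell g * ell (h * h1)%g =
  ell g * ell h1 + ell (g ^ h1)%g * ell (h ^ h1)%g)%R.
Proof. by rewrite ellM !ellJ mulrDr addrC. Qed.

Lemma sigM s t : sig (s * t) = (sig s + sig t)%R.
Proof. exact: (tensor_liftM (H := additive_group {poly int}) sig_mull sig_mulr). Qed.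

Lemma sig_tns g h : sig (tns g h) = (ell g * ell h)%R.
Proof. exact: (tensor_lift_tns (H := additive_group {poly int}) sig_mull sig_mulr). Qed.

Definition xexp (i : 'I_n) := (dig i * base ^ c)%N.

Lemma ell_xgen i : ell (xgen i) = 'X^(xexp i)%R.
Proof.
by rewrite ell_pr /mu free_lift_gen ent_letter // subSS subn0.
Qed.

Lemma xexp_inj (i j k l : 'I_n) : i <= j -> k <= l ->
  xexp i + xexp j = xexp k + xexp l -> i = k /\ j = l.
Proof.
move=> ij kl; rewrite /xexp -!mulnDl => /eqP.
rewrite eqn_pmul2r ?expn_gt0 ?expn_gt0 // => /eqP E.
have tl (a b : nat) : a <= b -> trunc_log 3 (3 ^ a + 3 ^ b)%N = b.
  move=> ab; apply: trunc_log_eq => //.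
  rewrite leq_addl /= expnS; have := leq_pexp2l (isT : 0 < 3) ab.
  by have : 0 < (3 ^ b)%N by [rewrite expn_gt0]; lia.
have jl : j = l by apply: val_inj; rewrite /= -(tl _ _ ij) -(tl _ _ kl); congr trunc_log.
split=> //; apply/val_inj/eqP; rewrite -(eqn_exp2l _ _ (isT : 1 < 3)).
by move: E; rewrite jl /dig => /addIn ->.
Qed.

(** Squares and symmetric commutators of the generators span the symmetric part
    freely, since their images are monomials with different exponents. *)
Lemma sig_ker t : gen (@symmetric_symbols G) t -> sig t = 0%R -> t = 1.
Proof.
pose A r : set T := [set s | (exists i, s = tns (xgen i) (xgen i) /\ r = xexp i + xexp i)
  \/ exists i j : 'I_n, [/\ i < j, s = tsym (xgen i) (xgen j) & r = xexp i + xexp j]].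
have A0 r s : A r s -> tdel s = 1.
  by case=> [[i [-> _]]|[i [j [_ -> _]]]]; [exact: tdel_sq|exact: tdel_tsym].
have sigA r s : A r s -> exists k, (sig s = 'X^r *+ k.+1)%R.
  case=> [[i [-> ->]]|[i [j [_ -> ->]]]].
    by exists 0%N; rewrite sig_tns !ell_xgen exprD.
  by exists 1%N; rewrite sigM !sig_tns !ell_xgen exprD mulr2n [X in (_ + X)%R]mulrC.
have sym_span : gen (@symmetric_symbols G) `<=`
    gen ([set s | exists r, A r s] `|` [set 1]).
  set S := gen (_ `|` _); have [S1 SM SV] := gen_subgroup _ : is_subgroup S.
  have Sx i j : S (tsym (xgen i) (xgen j)).
    case: (ltngtP i j) => [ij|ji|/val_inj ->].
    - by apply: sub_gen; left; exists (xexp i + xexp j); right; exists i, j.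
    - by rewrite tsymC; apply: sub_gen; left; exists (xexp j + xexp i); right; exists j, i.
    - by apply: SM; apply: sub_gen; left; exists (xexp j + xexp j); left; exists j.
  have tsym1l (h : G) : tsym 1 h = 1 by rewrite /tsym tns1g tnsg1 mulg1.
  have subl h : is_subgroup [set g | S (tsym g h)].
    split=> [|g g1 Sg Sg1|g Sg] /=; first by rewrite tsym1l.
      by rewrite tsymMl; exact: SM.
    have := tsym1l h; rewrite -{1}(mulVg g) tsymMl => /mulg1_eq E.
    by rewrite -[tsym g^-1 h]invgK E; exact: SV.
  have Ssym g h : S (tsym g h).
    move: g; apply: (xgen_ind (subl h)) => i /=; rewrite tsymC.
    by move: h; apply: (xgen_ind (subl (xgen i))) => j /=.
  have Ssq g : S (tns g g).
    move: g; apply: xgen_ind => [|i].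
      split=> [|g h Sg Sh|g Sg] /=; first by rewrite tns1g.
        by rewrite tsqM; apply: (SM _ _ (SM _ _ Sg Sh)).
      have : S (tns (g * g^-1) (g * g^-1)) by rewrite mulgV tns1g.
      rewrite tsqM => SS; have := SM _ _ (SV _ Sg) (SM _ _ SS (SV _ (Ssym g g^-1))).
      by rewrite mulgK mulKg.
    by apply: sub_gen; left; exists (xexp i + xexp i); left; exists i.
  by apply: gen_min => [|s [[g ->]|[g [h ->]]]] //; exact: gen_subgroup.
move=> /[dup] Dt /sym_span.
apply: (lowest_term_indep (D := gen (@symmetric_symbols G)) (f := sig) (A := A)
  (b := (base * base ^ c)%N.*2)).
- exact: gen_subgroup.
- split=> [//|x y -> ->|x ->] /=; [exact: mulg1|exact: invg1].
- by move=> _ ->; exact: gen1.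
- move=> r s [[i [-> _]]|[i [j [_ -> _]]]]; apply: sub_gen; [left|right].
    by exists (xgen i).
  by exists (xgen i), (xgen j).
- by move=> x y _ _; exact: sigM.
- by move=> _ ->; apply: (addrI (sig 1)); rewrite -sigM mulg1 addr0.
- move=> r s s' [[i [-> ->]]|[i [j [ij -> ->]]]] [[k [-> E]]|[k [l [kl -> E]]]].
  + by have [-> _] := xexp_inj (leqnn i) (leqnn k) E.
  + by have [ik il] := xexp_inj (leqnn i) (ltnW kl) E; rewrite -ik -il ltnn in kl.
  + by have [ik jk] := xexp_inj (ltnW ij) (leqnn k) E; rewrite ik jk ltnn in ij.
  + by have [-> ->] := xexp_inj (ltnW ij) (ltnW kl) E.
- by move=> r s /sigA[k ->] i ir; rewrite coefMn coefXn ltn_eqF // mul0rn.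
- by move=> r s /sigA[k ->]; rewrite coefMn coefXn eqxx Num.Theory.pnatr_eq0.
- move=> r s x /A0 s1 _; rewrite -invgR; apply/eqP.
  by rewrite invg_eq1; apply/commgP/tdel1_central.
- have xb i : xexp i < (base * base ^ c)%N by rewrite ltn_pmul2r ?dig_base // !expn_gt0.
  move=> r s H; have [i [j ->]] : exists i j, r = xexp i + xexp j.
    by case: H => [[i [_ ->]]|[i [j [_ _ ->]]]]; [exists i, i|exists i, j].
  by rewrite -addnn; have := xb i; have := xb j; lia.
Qed.

Lemma rep_sig_ker t : rep t = 1 -> sig t = 0%R -> t = 1.
Proof. by move=> /rep_ker; exact: sig_ker. Qed.

End Representation.
(** * Specialization to the complex numbers *)

Section Transcendental.
Import GRing.Theory Num.Theory.
Local Open Scope ring_scope.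
Local Open Scope classical_set_scope.
Variable R : realType.

Definition spec (x : R) : {poly int} -> R := horner_eval x \o map_poly intr.
HB.instance Definition _ x :=
  GRing.RMorphism.copy (spec x) (horner_eval x \o map_poly intr).

(** The algebraic numbers are countable, hence of Lebesgue measure zero. *)
Lemma exists_transcendental : exists x : R, injective (spec x).
Proof.
pose rts (p : {poly int}) : set R := [set x | root (map_poly intr p) x].
have cA : countable (\bigcup_(p in [set p : {poly int} | p != 0]) rts p).
  apply: bigcup_countable => [|p p0]; first exact: countableP.
  apply: finite_set_countable; apply: (sub_finite_set (B := [set` rootsR (map_poly intr p)])).
    have pR0 : map_poly (intr : int -> R) p != 0.
      by rewrite map_poly_eq0_id0 // intr_eq0 lead_coef_eq0.
    by move=> x px /=; rewrite -(roots_on_rootsR pR0) px andbT in_itv.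
  exact: finite_seq.
apply: contrapT => H.
have sub : [set` `[0, 1 : R]%R] `<=` \bigcup_(p in [set p : {poly int} | p != 0]) rts p.
  move=> x _; apply: contrapT => nx; apply: H; exists x.
  apply: raddf_inj => p px; apply/eqP; apply: contrapT => /negP p0.
  by apply: nx; exists p => //; apply/rootP.
have := etrans
  (esym (countable_lebesgue_measure0 (sub_countable (subset_card_le sub) cA)))
  (lebesgue_measure_itv `[0, 1 : R]%R).
by rewrite /= lte_fin ltr01 sube0 => /eqP; rewrite eq_sym eqe oner_eq0.
Qed.

End Transcendental.

Section Specialization.
Import GRing.Theory.
Local Open Scope ring_scope.
Variables (n c : nat) (K : fieldType) (psi : {rmorphism {poly int} -> K}).
Variable chi : {poly int} -> K.
Hypothesis c_gt0 : (0 < c)%N.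
Hypothesis psi_inj : injective psi.
Hypothesis chiD : forall p q, chi (p + q) = chi p * chi q.
Hypothesis chi_neq0 : forall p, chi p != 0.
Hypothesis chi_eq1 : forall p, chi p = 1 -> p = 0.
Local Notation T := (tensor_square (free_nilpotent n c)).

(** A scalar representation times a unipotent one: as scalar and unipotent
    matrices meet trivially, the kernel is the intersection of both kernels. *)
Definition rho_mx (t : T) : 'M[K]_c.+2 :=
  chi (sig t) *: map_mx psi (utm (rep t)).

Lemma rho_mxM s t : rho_mx (s * t)%g = rho_mx s *m rho_mx t.
Proof.
rewrite /rho_mx repM sigM // chiD utmM -[utm _ * utm _]/(utm _ *m utm _) map_mxM.
by rewrite -scalemxAl -scalemxAr scalerA.
Qed.

Lemma rho_mx_upper t : inv_upper (rho_mx t).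
Proof.
apply/andP; split.
  apply/is_trig_mxP => i j ij; rewrite !mxE utfil_upper ?rmorph0 ?mulr0 //.
  by rewrite addn0.
rewrite /rho_mx unitmxZ ?unitfE //.
have [E _ _ _] := unitriP (rep t).
have := map_mxM psi (utm (rep t)) (val (rep t)).2.
by rewrite -[_ *m _]/(_ * _) E map_mx1 => /esym/mulmx1_unit[].
Qed.

Definition rho_fun (t : T) : triangular K c.+2 :=
  exist (fun A => inv_upper A) _ (rho_mx_upper t).

Lemma rho_funM : {morph rho_fun : s t / (s * t)%g}.
Proof. by move=> s t; apply: val_inj; exact: rho_mxM. Qed.

Lemma rho_fun_inj : injective rho_fun.
Proof.
move=> s t st; apply/divg1_eq.
have : rho_fun (s / t)%g = 1%g.
  by rewrite rho_funM (morphgV rho_funM) st mulgV.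
move: (s / t)%g => u /(congr1 val) /=; rewrite /rho_mx => u1.
have chi1 : chi (sig u) = 1.
  have /matrixP/(_ ord0 ord0) := u1; rewrite !mxE.
  have -> : utm (rep u) ord0 ord0 = 1.
    have := utfil_weight1 (rep u) (i := ord0) (j := ord0) isT.
    by rewrite !mxE eqxx => /eqP; rewrite subr_eq0 => /eqP.
  by rewrite rmorph1 mulr1.
move: u1; rewrite chi1 scale1r => u1; apply: (rep_sig_ker c_gt0); last exact: chi_eq1.
apply: utm_inj; apply/matrixP => i j; apply: psi_inj.
by move/matrixP/(_ i j): u1; rewrite !mxE => ->; rewrite rmorph_nat.
Qed.

End Specialization.

Import GRing.Theory Num.Theory Order.TTheory.

Theorem proposition6p3 (R : realType) (n c : nat) (hn : 1 < n) (hc : 1 <= c) :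
  exists rho : {multiplicative tensor_square (free_nilpotent n c) ->
                               triangular (complex R) c.+2},
    injective rho.
Proof.
have [x x_inj] := exists_transcendental R.
pose psi : {rmorphism {poly int} -> complex R} := real_complex R \o spec x.
(* The exponential turns the additive invariant [sig] into a scalar. *)
pose chi p := real_complex R (expR (spec x p)).
have psi_inj : injective psi by move=> p q /complexI /x_inj.
have chiD p q : chi (p + q)%R = (chi p * chi q)%R.
  by rewrite /chi rmorphD expRD rmorphM.
have chi_neq0 p : chi p != 0%R by rewrite fmorph_eq0 gt_eqF // expR_gt0.
have chi_eq1 p : chi p = 1%R -> p = 0%R.
  move=> p1; apply: x_inj; rewrite rmorph0; apply: expR_inj; rewrite expR0.
  by apply: complexI; rewrite -[LHS]/(chi p) p1.
pose f := rho_fun (n := n) (c := c) psi chi_neq0.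
have fM : {morph f : s t / (s * t)%g} by exact: rho_funM.
pose rho : {multiplicative _ -> _} :=
  HB.pack f (isMultiplicative.Build _ _ f fM).
by exists rho; exact: rho_fun_inj.
Qed.
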